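(* Let $L_0,L_1,\ldots,L_r,H_0,H_1,\ldots,H_s\subsetneq\mathbb{P}^n$ ($n\geq 1$, $r\ge1$, $s\ge0$) be an inclic over a field $K$, and let $l_0,\ldots,l_r,h_1,\ldots,h_s$ be non-negative integers. Choose coordinates on $\mathbb{P}^n$ such that $I_{H_0}=(x_0)$ and $I_{L_0}=(x_{k+1},\ldots,x_n)$ in $R=K[x_0,\ldots,x_n]$, where $k=\dim L_0$, and let $\eta_j$ be a linear form defining $H_j$ for $j>0$. Let $Z=l_0L_0$, $W=\sum_{i=0}^r l_iL_i$, $X=\sum_{i=0}^r l_iL_i+\sum_{j=1}^s h_jH_j$, and let $l'=\max(l_1,\ldots,l_r)$. For each integer $t$ let $\lambda=\min(l'-1,t-l_0)$. Then $$I_X=\eta_1^{h_1}\cdots\eta_s^{h_s}I_W\quad\text{and}\quad h(I_X,t)=h\Big(I_W,t-\sum_{j>0}h_j\Big)$$ for all $t$, where $$I_W=\bigoplus_{j\ge0}x_0^j(I_{Y'_j})^{(k,l_0)}= \Big(\bigoplus_{0\leq j< l'}x_0^j(I_{Y'_j})^{(k,l_0)}\Big)\oplus\bigoplus_{j\geq l'} x_0^jI_{Z'}= \Big(\bigoplus_{0\leq j< l'}x_0^j(I_{Y'_j})^{(k,l_0)}\Big)\oplus x_0^{l'}I_Z,$$ and $$h(I_W,t) =\sum_{j=0}^\lambda h\big((I_{Y'_j})^{(k,l_0)},t-j\big) +h(I_Z,t-l'),$$ where $h(I_Z,t-l')=0$ if $t<l'+l_0$ and $$h(I_Z,t-l')=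 \binom{t-l'+n}{n}-\sum_{0\leq i<l_0}\binom{t-l'-i+k}{k}\binom{i+n-k-1}{n-k-1}$$ for $t\geq l'+l_0$.
   Context: Inclic: a collection of (nonempty, proper) linear subvarieties $L_0,\ldots,L_r,H_0,\ldots,H_s\subsetneq\mathbb{P}^n$ such that (C1) $H_0,\ldots,H_s$ are distinct hyperplanes; (C2) $L_i\subseteq H_0$ for $i>0$ but $L_0\not\subseteq H_0$; (C3) if $L_i\subseteq L_j$ then $i=j$; (C4) for all $i\ge0$ and $j>0$, $L_i\not\subseteq H_j$. For a linear subvariety $V\subset\mathbb{P}^n$, $I_V\subset R=K[x_0,\ldots,x_n]$ is the ideal generated by all forms vanishing on $V$. For non-negative integers, the scheme $\sum_i l_iL_i+\sum_{j>0}h_jH_j$ is the one defined by the ideal $\big(\bigcap_i I_{L_i}^{l_i}\big)\cap\big(\bigcap_{j>0}I_{H_j}^{h_j}\big)$; this defines $I_X$, $I_W$, $I_Z=I_{L_0}^{l_0}$. Let $R'=K[x_1,\ldots,x_n]\subset R$ (the coordinate ring of $H_0$). For $j\ge0$ let $Y_j=\sum_{i=1}^r\max(0,l_i-j)L_i$ and $Y'_j=Y_j\cap H_0$, with $I_{Y'_j}=I_{Y_j}\cap R'\subseteq R'$ (equal to $R'$ for $j\ge l'$). Let $I_{Z'}=I_Z\cap R'=(x_{k+1},\ldots,x_n)^{l_0}\subseteq R'$. For a homogeneous ideal $J'\subseteq R'$, put $J'^{(k,t)}=J'\cap (x_{k+1},\ldots,x_n)^t$, an ideal of $R'$. The direct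 sums are as $K$-vector subspaces of $R$. For a homogeneous ideal $J$ of $R$ (resp. $R'$), $h(J,t)=\dim_KJ_t$, where $J_t$ is the space of forms of degree $t$ in $J$; it is $0$ for $t<0$. A sum whose upper limit is less than its lower limit is $0$. *)

(* Defs.v *)
From HB Require Import structures.
From mathcomp Require Import all_boot all_order all_algebra.
From mathcomp Require Import mpoly.
From Stdlib Require Import ClassicalEpsilon.

Set Implicit Arguments.
Unset Strict Implicit.
Unset Printing Implicit Defensive.

Import GRing.Theory.
Local Open Scope ring_scope.

(* A linear subvariety of P^n is given by a matrix A with n+1 columns: it is
   the projectivization of the row space of A. *)
Definition is_linsub (K : fieldType) (n : nat) (A : 'M[K]_n.+1) : Prop :=
  (0 < \rank A < n.+1)%N.

Definition pdim (K : fieldType) (n : nat) (A : 'M[K]_n.+1) : nat :=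
  (\rank A).-1.

Definition is_hyperplane (K : fieldType) (n : nat) (A : 'M[K]_n.+1) : Prop :=
  is_linsub A /\ pdim A = n.-1.

Record inclic (K : fieldType) (n r s : nat)
    (L : 'I_r.+1 -> 'M[K]_n.+1) (H : 'I_s.+1 -> 'M[K]_n.+1) : Prop := Inclic {
  inclic_linsub : forall i, is_linsub (L i);
  inclic_hyperplane : forall j, is_hyperplane (H j);
  inclic_C1 : forall i j, (H i == H j)%MS -> i = j;
  inclic_C2 : (forall i, i != ord0 -> (L i <= H ord0)%MS)
              /\ ~~ (L ord0 <= H ord0)%MS;
  inclic_C3 : forall i j, (L i <= L j)%MS -> i = j;
  inclic_C4 : forall i j, j != ord0 -> ~~ (L i <= H j)%MS
}.

Section Ideals.
Variables (K : fieldType) (n : nat).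
Implicit Types (p q f : {mpoly K[n.+1]}) (S G I J : {mpoly K[n.+1]} -> Prop).

Definition eqset I J : Prop := forall p, I p <-> J p.

Definition meet I J : {mpoly K[n.+1]} -> Prop := fun p => I p /\ J p.

Definition ringR : {mpoly K[n.+1]} -> Prop := fun=> True.

(* R' = K[x_1, ..., x_n] as a subring of R. *)
Definition ringR' : {mpoly K[n.+1]} -> Prop :=
  fun p => forall m, m \in msupp p -> m ord0 = 0%N.

(* For a subring S of R and subsets G, I, J of S, the following are ideals of
   S: the one generated by G, the product of I and J, the m-th power of I
   (which is S for m = 0). *)
Definition igen S G : {mpoly K[n.+1]} -> Prop := fun p =>
  exists (N : nat) (a g : 'I_N -> {mpoly K[n.+1]}),
    (forall i, S (a i) /\ G (g i)) /\ p = \sum_(i < N) a i * g i.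

Definition imul S I J : {mpoly K[n.+1]} -> Prop :=
  igen S (fun p => exists f q, [/\ I f, J q & p = f * q]).

Definition ipow S I (m : nat) : {mpoly K[n.+1]} -> Prop := iter m (imul S I) S.

(* The points range over all extension fields F of K: for finite K, the
   K-rational points alone would not determine the ideal. *)
Definition vanishes_on (A : 'M[K]_n.+1) p : Prop :=
  forall (F : fieldType) (iota : {rmorphism K -> F}) (v : 'rV[F]_n.+1),
    v != 0 -> (v <= map_mx iota A)%MS ->
    (map_mpoly iota p).@[fun i => v 0 i] = 0.

Definition Ivar (A : 'M[K]_n.+1) : {mpoly K[n.+1]} -> Prop :=
  igen ringR (fun f => (exists d : nat, f \is d.-homog) /\ vanishes_on A f).

Definition Ischeme (T : finType) (V : T -> 'M[K]_n.+1) (m : T -> nat) :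
    {mpoly K[n.+1]} -> Prop :=
  fun p => forall i, ipow ringR (Ivar (V i)) (m i) p.

Definition is_linear_form_of f (A : 'M[K]_n.+1) : Prop :=
  f \is 1.-homog /\
  forall v : 'rV[K]_n.+1, (v <= A)%MS <-> f.@[fun i => v 0 i] = 0.

Definition xvar0 : {mpoly K[n.+1]} := 'X_(@ord0 n).

Definition xvars_gt (k : nat) : {mpoly K[n.+1]} -> Prop :=
  fun p => exists2 i : 'I_n.+1, (k < i)%N & p = 'X_i.

Definition scale_set f I : {mpoly K[n.+1]} -> Prop :=
  fun p => exists2 q, I q & p = f * q.

(* J'^(k,t), for an ideal J' of R' *)
Definition trunc J (k t : nat) : {mpoly K[n.+1]} -> Prop :=
  meet J (ipow ringR' (igen ringR' (xvars_gt k)) t).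

(* For K-subspaces F j of R indexed by the j in P: their sum, and the property
   that this sum is direct. *)
Definition sum_set (P : pred nat) (F : nat -> {mpoly K[n.+1]} -> Prop) :
    {mpoly K[n.+1]} -> Prop := fun p =>
  exists (N : nat) (f : nat -> {mpoly K[n.+1]}),
    (forall j, (j < N)%N -> P j -> F j (f j)) /\ p = \sum_(j < N | P j) f j.

Definition sum_is_direct (P : pred nat)
    (F : nat -> {mpoly K[n.+1]} -> Prop) : Prop :=
  forall (N : nat) (f : nat -> {mpoly K[n.+1]}),
    (forall j, (j < N)%N -> P j -> F j (f j)) ->
    \sum_(j < N | P j) f j = 0 ->
    forall j, (j < N)%N -> P j -> f j = 0.

Definition is_direct_sum I (P : pred nat)
    (F : nat -> {mpoly K[n.+1]} -> Prop) : Prop :=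
  eqset I (sum_set P F) /\ sum_is_direct P F.

Definition is_direct_sum2 I J1 J2 : Prop :=
  (forall p, I p <-> exists p1 p2, [/\ J1 p1, J2 p2 & p = p1 + p2]) /\
  (forall p1 p2, J1 p1 -> J2 p2 -> p1 + p2 = 0 -> p1 = 0 /\ p2 = 0).

(* J_d as a subspace of the space of forms of degree d; this is meaningful
   whenever J is closed under K-linear combinations. *)
Definition forms_of J (d : nat) : {vspace dhomog n.+1 K d} :=
  epsilon (inhabits 0%VS)
    (fun U : {vspace dhomog n.+1 K d} =>
       forall p : dhomog n.+1 K d, p \in U <-> J (val p)).

Definition hilb J (t : int) : nat :=
  if t is Posz d then \dim (forms_of J d) else 0%N.

End Ideals.

Arguments ringR {K n}.
Arguments ringR' {K n}.
Arguments xvar0 {K n}.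
Arguments xvars_gt {K n}.

(* Sum over 0 <= j <= b, zero if b < 0. *)
Definition sum_upto (b : int) (F : nat -> nat) : nat :=
  if b is Posz m then (\sum_(j < m.+1) F j)%N else 0%N.

(* Binomial coefficient with an integer on top; only used with a >= 0. *)
Definition binz (a : int) (b : nat) : int :=
  if a is Posz m then 'C(m, b)%:Z else 0.

(* Coordinates in which H0 is x_0 = 0 and L0 is x_(k+1) = ... = x_n = 0, with
   k = dim L0. *)
Definition adapted (K : fieldType) (n : nat) (L0 H0 : 'M[K]_n.+1) : Prop :=
  eqset (Ivar H0) (igen ringR (fun p => p = xvar0)) /\
  eqset (Ivar L0) (igen ringR (xvars_gt (pdim L0))).

Section Schemes.
Variables (K : fieldType) (n r s : nat).
Variables (L : 'I_r.+1 -> 'M[K]_n.+1) (H : 'I_s.+1 -> 'M[K]_n.+1).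
Variables (l : 'I_r.+1 -> nat) (h : 'I_s -> nat).
(* h j and H (lift ord0 j) are h_(j+1) and H_(j+1) in 1-based numbering. *)

Definition IZ : {mpoly K[n.+1]} -> Prop :=
  ipow ringR (Ivar (L ord0)) (l ord0).

Definition IZ' : {mpoly K[n.+1]} -> Prop := meet IZ ringR'.

Definition IW : {mpoly K[n.+1]} -> Prop := Ischeme L l.

Definition IX : {mpoly K[n.+1]} -> Prop :=
  meet (Ischeme L l) (Ischeme (fun j : 'I_s => H (lift ord0 j)) h).

Definition IY (j : nat) : {mpoly K[n.+1]} -> Prop :=
  Ischeme (fun i : 'I_r => L (lift ord0 i))
          (fun i : 'I_r => (l (lift ord0 i) - j)%N).

Definition IY' (j : nat) : {mpoly K[n.+1]} -> Prop := meet (IY j) ringR'.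

Definition lmax : nat := (\max_(i < r) l (lift ord0 i))%N.

End Schemes.

(* Main.v *)
(* Let P be a matrix projecting onto a linear subvariety V. A polynomial p lies
   in I_V iff p(xP) = 0: evaluate p at the generic point xP of V, with
   coordinates in Frac R. Expanding p(xP + T (x - xP)) in powers of T, the
   coefficient of T^j lies in I_V^j (the Rees algebra of I_V is a ring), and
   T = 1 gives p back; so p lies in I_V^m iff the coefficients of T^j vanish for
   j < m. As R[T] is a domain, a linear form outside I_V is then a non-zero
   divisor modulo I_V^m, which lets one split the eta_j off I_X.

   Write p = sum_j x_0^j p_j with p_j in R'. If x_0 is in I_V, as for
   V = L_i with i > 0, then p is in I_V^m iff every p_j is in I_V^(m - j); if
   I_V is generated in R', as for V = L_0, then p is in I_V^m iff every p_j is.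
   This is the decomposition of I_W, and taking off one x_0 at a time gives the
   Hilbert function. That of I_Z counts monomials by their degree in
   x_(k+1), ..., x_n. *)
Require Import Defs.
From HB Require Import structures.
From mathcomp Require Import all_boot all_order all_algebra.
From mathcomp Require Import mpoly zify.
From Stdlib Require Import ClassicalEpsilon.

Set Implicit Arguments.
Unset Strict Implicit.
Unset Printing Implicit Defensive.

Import GRing.Theory Num.Theory.
Local Open Scope ring_scope.

(** * Ideals *)

(** A monomial is a product of variables, so a property closed under sums and products need only be
    checked on constants and variables. This serves for identities between substitution morphisms
    and for membership of their coefficients in ideals. *)
Lemma mpoly_alg_ind (R : nzRingType) (N : nat) (P : {mpoly R[N]} -> Prop) :
  (forall c, P c%:MP) -> (forall p q, P p -> P q -> P (p + q)) ->
  (forall p q, P p -> P q -> P (p * q)) -> (forall i, P 'X_i) ->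
  forall p, P p.
Proof.
move=> PC PD PM PX p; rewrite [p]mpolyE.
apply: big_ind => [||m _]; [by rewrite -mpolyC0|exact: PD|].
rewrite -mul_mpolyC; apply: (PM) => //.
rewrite mpolyXE_id; apply: big_ind => [||i _]; [by rewrite -mpolyC1|exact: PM|].
by elim: (m i) => [|e IH]; [rewrite expr0 -mpolyC1|rewrite exprS; exact: PM].
Qed.

(** In every term p_i q_(j-i) either i < a or j - i < b: orders of vanishing at T = 0 add up. *)
Lemma coef_ltM (R : nzRingType) (a b : nat) (p q : {poly R}) :
  (forall j, (j < a)%N -> p`_j = 0) -> (forall j, (j < b)%N -> q`_j = 0) ->
  forall j, (j < a + b)%N -> (p * q)`_j = 0.
Proof.
move=> p0 q0 j ltj; rewrite coefM big1 // => i _.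
have [lti|lei] := ltnP i a; first by rewrite p0 ?mul0r.
have leij : (i <= j)%N by rewrite -ltnS.
by rewrite q0 ?mulr0 // ltn_subLR // (leq_trans ltj) // leq_add2r.
Qed.

(** Strong induction on j: in the coefficient of index j of the product, every term but p_0 q_j
    vanishes already. *)
Lemma coef_ltM_cancel (R : idomainType) (b : nat) (p q : {poly R}) :
  p`_0 != 0 -> (forall j, (j < b)%N -> (p * q)`_j = 0) ->
  forall j, (j < b)%N -> q`_j = 0.
Proof.
move=> p0 pq0 j; have [c] := ubnP j; elim: c j => // c IH j ltjc ltjb.
have := pq0 j ltjb; rewrite coefM big_ord_recl subn0 big1 ?addr0; last first.
  move=> [i lti] _ /=; rewrite /bump /= add1n IH ?mulr0 //.
    by rewrite -ltnS (leq_trans _ ltjc) // !ltnS ltn_subrL; case: (j) lti.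
  by apply: leq_ltn_trans ltjb; rewrite leq_subr.
by move/eqP; rewrite mulf_eq0 (negPf p0) => /eqP.
Qed.

Section IdealArithmetic.
Variables (K : fieldType) (n : nat).
Local Notation R := {mpoly K[n.+1]}.
Implicit Types (p q f g : R) (S G I J : R -> Prop).

Definition subalg S : Prop :=
  [/\ forall c, S c%:MP, forall p q, S p -> S q -> S (p + q)
    & forall p q, S p -> S q -> S (p * q)].

(** In effect an [S]-submodule of R, so that an ideal of a larger ring also qualifies; [ipow_mono]
    relies on this. *)
Definition ideal_of S I : Prop :=
  [/\ I 0, forall p q, I p -> I q -> I (p + q)
    & forall p q, S p -> I q -> I (p * q)].

Lemma ideal_sum S I (T : Type) (r : seq T) (P : pred T) (F : T -> R) :
  ideal_of S I -> (forall i, P i -> I (F i)) -> I (\sum_(i <- r | P i) F i).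
Proof. by case=> I0 ID _ IF; apply: big_ind. Qed.

Lemma idealZ S I : subalg S -> ideal_of S I ->
  forall c p, I p -> I (c *: p).
Proof. by case=> SC _ _ [_ _ IM] c p Ip; rewrite -mul_mpolyC; apply: IM. Qed.

Lemma idealB S I : subalg S -> ideal_of S I ->
  forall p q, I p -> I q -> I (p - q).
Proof.
move=> HS HI p q Ip Iq; case: (HI) => _ ID _; apply: ID => //.
by rewrite -scaleN1r; apply: idealZ HI _ _ _.
Qed.

Lemma subalg_ideal S : subalg S -> ideal_of S S.
Proof. by case=> SC SD SM; split=> //; rewrite -mpolyC0. Qed.

Lemma igen_ideal S G : subalg S -> ideal_of S (igen S G).
Proof.
case=> SC SD SM; split.
- exists 0%N, (fun=> 0), (fun=> 0); split; last by rewrite big_ord0.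
  by case.
- move=> _ _ [N1 [a1 [g1 [H1 ->]]]] [N2 [a2 [g2 [H2 ->]]]].
  exists (N1 + N2)%N,
    (fun i => match split i with inl i1 => a1 i1 | inr i2 => a2 i2 end),
    (fun i => match split i with inl i1 => g1 i1 | inr i2 => g2 i2 end).
  split; first by move=> i; case: (split i).
  rewrite big_split_ord /=; congr (_ + _); apply: eq_bigr => i _.
    by rewrite (unsplitK (inl _ i)).
  by rewrite (unsplitK (inr _ i)).
- move=> p _ Sp [N [a [g [H ->]]]]; exists N, (fun i => p * a i), g; split.
    by move=> i; have [Sa Gg] := H i; split=> //; apply: SM.
  by rewrite big_distrr /=; apply: eq_bigr => i _; rewrite mulrA.
Qed.

Lemma igen_in S G p : subalg S -> G p -> igen S G p.
Proof.
case=> SC _ _ Gp; exists 1%N, (fun=> 1), (fun=> p); split.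
  by move=> _; split=> //; rewrite -mpolyC1.
by rewrite big_ord_recl big_ord0 addr0 mul1r.
Qed.

Lemma igen_sub S G I : ideal_of S I -> (forall p, G p -> I p) ->
  forall p, igen S G p -> I p.
Proof.
move=> HI GI _ [N [a [g [H ->]]]]; apply: (ideal_sum _ HI) => i _.
by have [Sa Gg] := H i; case: HI => _ _; apply=> //; apply: GI.
Qed.

Lemma ipow_ideal S I m : subalg S -> ideal_of S (ipow S I m).
Proof.
by move=> HS; case: m => [|m]; [apply: subalg_ideal | apply: igen_ideal].
Qed.

(** To bound all powers of [I] at once, it is enough to have a family of ideals E_m with I E_m
    inside E_(m+1); explicit sums of products never appear afterwards. *)
Lemma ipow_ind S I (E : nat -> R -> Prop) : subalg S ->
  (forall p, S p -> E 0%N p) -> (forall m, ideal_of S (E m)) ->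
  (forall m p q, I p -> E m q -> E m.+1 (p * q)) ->
  forall m p, ipow S I m p -> E m p.
Proof.
move=> HS SE EI IE; elim=> [|m IH]; first exact: SE.
apply: igen_sub (EI _) _ => _ [f [q [If Eq ->]]]; exact/IE/IH.
Qed.

Lemma ipowSM S I m p q : subalg S -> I p -> ipow S I m q ->
  ipow S I m.+1 (p * q).
Proof. by move=> HS Ip Iq; apply: igen_in => //; exists p, q. Qed.

Lemma ipowM S I a b p q : subalg S -> ipow S I a p -> ipow S I b q ->
  ipow S I (a + b) (p * q).
Proof.
move=> HS Ip Iq; pose E m f := ipow S I (m + b) (f * q).
apply: (@ipow_ind S I E _ _ _ _ _ _ Ip) => {a p Ip} //.
- by move=> p Sp; case: (ipow_ideal I b HS) => _ _; apply.
- move=> m; case: (ipow_ideal I (m + b) HS) => I0 ID IM; split.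
  + by rewrite /E mul0r.
  + by move=> p f; rewrite /E mulrDl; apply: ID.
  + by move=> p f Sp; rewrite /E -mulrA; apply: IM.
- by move=> m p f Ip; rewrite /E -mulrA => /(ipowSM HS Ip).
Qed.

Lemma ipow_exp S I m p : subalg S -> I p -> ipow S I m (p ^+ m).
Proof.
move=> HS Ip; elim: m => [|m IH]; last by rewrite exprS; apply: ipowSM.
by case: HS => SC _ _; rewrite expr0 -mpolyC1; apply: SC.
Qed.

Lemma ipow_anti S I a b p : subalg S -> (forall q, I q -> S q) ->
  (a <= b)%N -> ipow S I b p -> ipow S I a p.
Proof.
move=> HS IS /subnK <-; elim: (b - a)%N p => // c IH p Hp; apply: IH.
move: p Hp; apply: igen_sub (ipow_ideal _ _ HS) _ => _ [f [q [If Iq ->]]].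
by case: (ipow_ideal I (c + a) HS) => _ _; apply=> //; apply: IS.
Qed.

Lemma ipow_mono S S' I I' m p : subalg S -> subalg S' ->
  (forall q, S q -> S' q) -> (forall q, I q -> I' q) ->
  ipow S I m p -> ipow S' I' m p.
Proof.
move=> HS HS' SS' II'; apply: ipow_ind => // [{}m|{}m f q If].
  case: (ipow_ideal I' m HS') => I0 ID IM; split=> // f q /SS'; exact: IM.
exact/ipowSM/II'.
Qed.

Lemma subalg_ringR : subalg (@ringR K n).
Proof. by []. Qed.

Lemma ipow_anti_ringR I a b p : (a <= b)%N ->
  ipow ringR I b p -> ipow ringR I a p.
Proof. exact: ipow_anti. Qed.

Lemma eq_ipow I J m : eqset I J -> eqset (ipow ringR I m) (ipow ringR J m).
Proof. by move=> IJ p; split; apply: ipow_mono => // q /IJ. Qed.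

Lemma ideal_Ischeme (T : finType) (V : T -> 'M[K]_n.+1) (m : T -> nat) :
  ideal_of ringR (Ischeme V m).
Proof.
split=> [i|p q Hp Hq i|p q _ Hq i];
case: (ipow_ideal (Ivar (V i)) (m i) subalg_ringR) => I0 ID IM //.
  by apply: ID; [apply: Hp | apply: Hq].
by apply: IM => //; apply: Hq.
Qed.

Lemma subalg_ringR' : subalg (@ringR' K n).
Proof.
split=> [c m|p q Hp Hq m /msuppD_le|p q Hp Hq m /msuppM_le].
- by rewrite msuppC; case: (c == 0); rewrite ?inE // => /eqP ->; rewrite mnm0E.
- by rewrite mem_cat => /orP[/Hp|/Hq].
- by move=> /allpairsP[[m1 m2] /= [/Hp E1 /Hq E2 ->]]; rewrite mnmDE E1 E2.
Qed.

Lemma ringR'_X (i : 'I_n.+1) : i != ord0 -> @ringR' K n 'X_i.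
Proof.
by move=> i0 m; rewrite msuppX inE => /eqP ->; rewrite mnm1E (negPf i0).
Qed.

End IdealArithmetic.

(** * Projections onto a linear subvariety *)

(** The i-th coordinate of xP, where x is the row vector of the variables. *)
Definition lin (K : fieldType) (n : nat) (P : 'M[K]_n.+1) (i : 'I_n.+1) :
    {mpoly K[n.+1]} := \sum_j P j i *: 'X_j.

(* [psub] and [blow] are locked because failed attempts to unify two of their
   values otherwise unfold the polynomials. *)
HB.lock Definition psub (K : fieldType) (n : nat) (P : 'M[K]_n.+1) :
    {mpoly K[n.+1]} -> {mpoly K[n.+1]} := mmap (@mpolyC _ _) (lin P).

(* The deformation x |-> xP + T (x - xP). *)
HB.lock Definition blow (K : fieldType) (n : nat) (P : 'M[K]_n.+1) :
    {mpoly K[n.+1]} -> {poly {mpoly K[n.+1]}} :=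
  mmap (polyC \o @mpolyC _ _)
       (fun i => (lin P i)%:P + ('X_i - lin P i)%:P * 'X).

Section Projection.
Variables (K : fieldType) (n : nat).
Local Notation R := {mpoly K[n.+1]}.
Implicit Types (p q f g : R) (A P : 'M[K]_n.+1).

Lemma psubC P c : psub P c%:MP = c%:MP.
Proof. by rewrite psub.unlock mmapC. Qed.

Lemma psubX P i : psub P 'X_i = lin P i.
Proof. by rewrite psub.unlock mmapX mmap1U. Qed.

Lemma psubD P : {morph psub P : p q / p + q}.
Proof. by rewrite psub.unlock; apply: rmorphD. Qed.

Lemma psubM P : {morph psub P : p q / p * q}.
Proof. by rewrite psub.unlock; apply: rmorphM. Qed.

Lemma psub0 P : psub P 0 = 0.
Proof. by rewrite -mpolyC0 psubC. Qed.

Lemma blowC P c : blow P c%:MP = (c%:MP)%:P.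
Proof. by rewrite blow.unlock mmapC. Qed.

Lemma blowX P i : blow P 'X_i = (lin P i)%:P + ('X_i - lin P i)%:P * 'X.
Proof. by rewrite blow.unlock mmapX mmap1U. Qed.

Lemma blowD P : {morph blow P : p q / p + q}.
Proof. by rewrite blow.unlock; apply: rmorphD. Qed.

Lemma blowM P : {morph blow P : p q / p * q}.
Proof. by rewrite blow.unlock; apply: rmorphM. Qed.

Lemma blow0 P : blow P 0 = 0.
Proof. by rewrite -mpolyC0 blowC. Qed.

(** Such a [P] is idempotent with the row space of [A]: writing P = WA gives PP = WAP = WA = P. *)
Definition is_proj A P : Prop := (P <= A)%MS /\ A *m P = A.

Lemma ex_proj A : exists P, is_proj A P.
Proof.
exists (pinvmx A *m A); split; first exact: submxMl.
by rewrite mulmxA mulmxKpV.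
Qed.

Lemma blow_coef0 P p : (blow P p)`_0 = psub P p.
Proof.
elim/mpoly_alg_ind: p => [c|p q Ep Eq|p q Ep Eq|i].
- by rewrite blowC psubC coefC.
- by rewrite psubD blowD coefD Ep Eq.
- by rewrite blowM psubM coef0M Ep Eq.
- by rewrite blowX psubX coefD coefC coefMX addr0.
Qed.

Lemma blow_at1 P p : (blow P p).[1] = p.
Proof.
elim/mpoly_alg_ind: p => [c|p q Ep Eq|p q Ep Eq|i].
- by rewrite blowC hornerC.
- by rewrite blowD hornerD Ep Eq.
- by rewrite blowM hornerM Ep Eq.
- by rewrite blowX hornerD hornerM !hornerC hornerX mulr1 addrC subrK.
Qed.

Lemma dhomog_lin P i : lin P i \is 1.-homog.
Proof.
by apply: rpred_sum => j _; apply: rpredZ; rewrite dhomogX /= mdeg1.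
Qed.

Lemma map_lin_eval P (F : fieldType) (iota : {rmorphism K -> F})
    (v : 'rV[F]_n.+1) i :
  (map_mpoly iota (lin P i)).@[fun j => v 0 j] = (v *m map_mx iota P) 0 i.
Proof.
rewrite /lin (raddf_sum (map_mpoly iota)) (raddf_sum (meval _)) mxE.
apply: eq_bigr => j _.
by rewrite /= map_mpolyZ map_mpolyX mevalZ mevalXU mxE mulrC.
Qed.

(** The extension field to use is Frac R and the point is xP, the generic point of the subvariety;
    evaluation there is [psub P]. *)
Lemma vanishes_psub A P p : (0 < \rank A)%N -> is_proj A P ->
  vanishes_on A p -> psub P p = 0.
Proof.
move=> rA [PA AP] vp.
pose F : fieldType := {fraction R}.
pose iota : {rmorphism K -> F} := (@tofrac R \o @mpolyC n.+1 K).
pose x : 'rV[F]_n.+1 := \row_j tofrac ('X_j : R).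
pose v := x *m map_mx iota P.
have vE i : v 0 i = tofrac (lin P i).
  rewrite mxE rmorph_sum; apply: eq_bigr => j _.
  by rewrite !mxE /= -mul_mpolyC rmorphM mulrC.
have vev q : (map_mpoly iota q).@[fun i => v 0 i] = tofrac (psub P q).
  elim/mpoly_alg_ind: q => [c|q1 q2 E1 E2|q1 q2 E1 E2|i].
  - by rewrite map_mpolyC mevalC psubC.
  - rewrite psubD rmorphD mevalD rmorphD; congr (_ + _); [exact: E1|exact: E2].
  - rewrite psubM rmorphM mevalM rmorphM; congr (_ * _); [exact: E1|exact: E2].
  - by rewrite map_mpolyX mevalXU psubX vE.
apply/eqP; rewrite -tofrac_eq0 -vev; apply/eqP/vp.
  (* The generic point is a nonzero vector: otherwise every [lin P i], hence [P], hence [A = A *m P]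
     would be zero. *)
  apply: contraL rA => /eqP v0; rewrite lt0n negbK mxrank_eq0 -AP.
  suff -> : P = 0 by rewrite mulmx0.
  apply/matrixP => j i; rewrite mxE.
  have /eqP := vE i; rewrite v0 mxE eq_sym tofrac_eq0 => /eqP.
  move/(congr1 (mcoeff U_(j))); rewrite mcoeff0 raddf_sum (bigD1 j) //=.
  rewrite big1 ?addr0 => [|a aj]; first by rewrite mcoeffZ mcoeffXU eqxx mulr1.
  by rewrite mcoeffZ mcoeffXU (negPf aj) mulr0.
by apply: submx_trans (submxMl _ _) _; rewrite map_submx.
Qed.

(** Modulo the x_i - (xP)_i, substituting xP for x changes nothing. With primes for the
    substitution, products follow from pq - p'q' = q(p - p') + p'(q - q'). *)
Lemma mpoly_psub_igen P p :
  igen ringR (fun q => exists i, q = 'X_i - lin P i) (p - psub P p).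
Proof.
set J := igen _ _; have HJ : ideal_of ringR J by apply: igen_ideal.
have [J0 JD JM] := HJ.
elim/mpoly_alg_ind: p => [c|p q Ep Eq|p q Ep Eq|i].
- by rewrite psubC subrr.
- by rewrite psubD opprD addrACA; apply: JD.
- rewrite psubM (_ : _ - _ = q * (p - psub P p) + psub P p * (q - psub P q)).
    by apply: JD; apply: JM.
  by rewrite !mulrBr addrA [q * psub P p]mulrC subrK mulrC.
- by rewrite psubX; apply: igen_in => //; exists i.
Qed.

Lemma Ivar_gen_sub A P i : is_proj A P -> Ivar A ('X_i - lin P i).
Proof.
case=> PA AP; apply: igen_in => //; split.
  exists 1%N; apply: rpredB; last exact: dhomog_lin.
  by rewrite dhomogX /= mdeg1.
move=> F iota v _ vA; rewrite rmorphB mevalB map_lin_eval /=.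
rewrite map_mpolyX mevalXU; suff -> : v *m map_mx iota P = v by rewrite subrr.
by have /submxP[w ->] := vA; rewrite -mulmxA -map_mxM AP.
Qed.

(** This makes [Ivar A] the kernel of a ring morphism into a domain. If p(xP) = 0, then p = p -
    p(xP) lies in the ideal of the x_i - (xP)_i. *)
Lemma IvarP A P p : (0 < \rank A)%N -> is_proj A P ->
  Ivar A p <-> psub P p = 0.
Proof.
move=> rA HP; split=> [|p0].
  apply: (@igen_sub _ _ ringR _ (fun p => psub P p = 0)) => [|q [_]].
    split=> [|f g Ef Eg|f g _ Eg]; first exact: psub0.
      by rewrite psubD Ef Eg addr0.
    by rewrite psubM Eg mulr0.
  exact: vanishes_psub.
rewrite -[p]subr0 -p0; apply: igen_sub (mpoly_psub_igen P p).
  exact: igen_ideal.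
by move=> _ [i ->]; apply: Ivar_gen_sub.
Qed.

Lemma Ivar_igen A P : (0 < \rank A)%N -> is_proj A P ->
  eqset (Ivar A) (igen ringR (fun q => exists i, q = 'X_i - lin P i)).
Proof.
move=> rA HP p; split=> [/(IvarP _ rA HP) p0|].
  by rewrite -[p]subr0 -p0; apply: mpoly_psub_igen.
apply: igen_sub; first exact: igen_ideal.
by move=> _ [i ->]; apply: Ivar_gen_sub.
Qed.

(** A variable contributes x_i - (xP)_i, an element of I_V, in degree 1 of T; products go through
    because I^i I^(j-i) is contained in I^j. *)
Lemma blow_coef_ipow A P p j : is_proj A P ->
  ipow ringR (Ivar A) j (blow P p)`_j.
Proof.
move=> HP; pose I m := ipow ringR (Ivar A) m.
have HI m : ideal_of ringR (I m) by apply: ipow_ideal.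
elim/mpoly_alg_ind: p j => [c|p q Ep Eq|p q Ep Eq|i] j.
- rewrite blowC coefC; case: eqP => [->//|_]; by have [] := HI j.
- by rewrite blowD coefD;
  have [_ ID _] := HI j; apply: ID; [apply: Ep|apply: Eq].
- rewrite blowM coefM; apply: (ideal_sum _ (HI j)) => i _.
  have leij : (i <= j)%N by rewrite -ltnS.
  by rewrite /I -[X in ipow _ _ X](subnKC leij); apply: ipowM.
- rewrite blowX coefD coefC coefMX coefC; case: j => [|[|j]] //=.
    rewrite add0r -[_ - _]mulr1; apply: (@ipowSM _ _ ringR (Ivar A) 0) => //.
    exact: Ivar_gen_sub.
  by rewrite addr0; have [] := HI j.+2.
Qed.

(* The Rees algebra sum_j I^j T^j contains every blow P p, and p is recovered
   at T = 1. *)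
Lemma ipow_IvarP A P m p : (0 < \rank A)%N -> is_proj A P ->
  ipow ringR (Ivar A) m p <-> forall j, (j < m)%N -> (blow P p)`_j = 0.
Proof.
move=> rA HP; split=> [|p0].
  pose E m f := forall j, (j < m)%N -> (blow P f)`_j = 0.
  apply: (@ipow_ind _ _ ringR (Ivar A) E) => // [{}m|{}m f q If Eq].
    split=> [j _|f q Ef Eq j lt|f q _ Eq]; first by rewrite blow0 coef0.
      by rewrite blowD coefD Ef // Eq // addr0.
    by rewrite /E blowM -[m]add0n; apply: coef_ltM.
  rewrite /E blowM -add1n; apply: coef_ltM => // -[|//] _.
  by rewrite blow_coef0; apply/(IvarP _ rA HP).
rewrite -(blow_at1 P p) horner_coef.
have HI := ipow_ideal (Ivar A) m (@subalg_ringR K n).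
apply: (ideal_sum _ HI) => j _; rewrite expr1n mulr1.
have [ltjm|lemj] := ltnP j m; first by rewrite p0 //; case: HI.
by apply: ipow_anti_ringR lemj _; apply: blow_coef_ipow.
Qed.

(** The constant term f(xP) of [blow P f] is nonzero as f is not in I_V, so [blow P f] can be
    cancelled from a product divisible by T^m. *)
Lemma ipow_Ivar_cancel A m f q : (0 < \rank A)%N -> ~ Ivar A f ->
  ipow ringR (Ivar A) m (f * q) -> ipow ringR (Ivar A) m q.
Proof.
move=> rA If; have [P HP] := ex_proj A.
move/(ipow_IvarP _ _ rA HP) => fq0; apply/(ipow_IvarP _ _ rA HP).
apply: (coef_ltM_cancel (p := blow P f)).
  by rewrite blow_coef0; apply/eqP => /(IvarP _ rA HP).
by move=> j ltj; rewrite -blowM fq0.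
Qed.

Lemma ipow_Ivar_cancelX A m e f q : (0 < \rank A)%N -> ~ Ivar A f ->
  ipow ringR (Ivar A) m (f ^+ e * q) -> ipow ringR (Ivar A) m q.
Proof.
move=> rA If; elim: e => [|e IH]; first by rewrite expr0 mul1r.
by rewrite exprS -mulrA => /(ipow_Ivar_cancel rA If).
Qed.

Lemma Ivar_sub A B p : (A <= B)%MS -> Ivar B p -> Ivar A p.
Proof.
move=> AB; apply: igen_sub; first exact: igen_ideal.
move=> f [fh fv]; apply: igen_in => //; split=> // F iota v v0 vA.
by apply: fv => //; apply: submx_trans vA _; rewrite map_submx.
Qed.

Lemma meval_psub P p (v : 'rV[K]_n.+1) :
  (psub P p).@[fun i => v 0 i] = p.@[fun i => (v *m P) 0 i].
Proof.
elim/mpoly_alg_ind: p => [c|p q Ep Eq|p q Ep Eq|i].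
- by rewrite psubC !mevalC.
- by rewrite psubD !mevalD Ep Eq.
- by rewrite psubM !mevalM Ep Eq.
- rewrite psubX mevalXU (raddf_sum (meval _)) mxE; apply: eq_bigr => j _.
  by rewrite /= mevalZ mevalXU mulrC.
Qed.

(** A vector v of the row space satisfies v = vP, so p(v) is the value at v of p(xP) = 0. *)
Lemma Ivar_eval A p (v : 'rV[K]_n.+1) : (0 < \rank A)%N -> (v <= A)%MS ->
  Ivar A p -> p.@[fun i => v 0 i] = 0.
Proof.
move=> rA vA Ip; have [P HP] := ex_proj A.
have := meval_psub P p v; rewrite ((IvarP _ rA HP).1 Ip) meval0.
by have [w ->] := submxP vA; rewrite -mulmxA; case: HP => _ ->.
Qed.

End Projection.

(** * Linear forms *)

Section LinearForms.
Variables (K : fieldType) (n : nat).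
Local Notation R := {mpoly K[n.+1]}.
Implicit Types (p q f g : R) (A B P : 'M[K]_n.+1).

Lemma dhomog1E f : f \is 1.-homog -> f = \sum_i f@_U_(i) *: 'X_i.
Proof.
move=> fh; apply/mpolyP => m; rewrite raddf_sum /=.
have [|m1] := boolP (mdeg m == 1%N).
  rewrite mdeg_eq1 => /existsP[a /eqP ->]; rewrite (bigD1 a) //= big1.
    by rewrite mcoeffZ mcoeffXU eqxx mulr1 addr0.
  by move=> i ia; rewrite mcoeffZ mcoeffXU (negPf ia) mulr0.
rewrite (dhomog_nemf_coeff fh) // big1 // => i _.
rewrite mcoeffZ mcoeffX; case: eqP => [E|]; last by rewrite mulr0.
by rewrite -E mdeg1 eqxx in m1.
Qed.

Lemma meval_dhomog1 f (v : 'I_n.+1 -> K) : f \is 1.-homog ->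
  f.@[v] = \sum_i f@_U_(i) * v i.
Proof.
move=> fh; rewrite {1}(dhomog1E fh) raddf_sum /=.
by apply: eq_bigr => i _; rewrite mevalZ mevalXU.
Qed.

(* With f = sum_i c_i x_i and c_a != 0, the map v |-> v - (f(v) / c_a) e_a is a
   projection onto {f = 0}. *)
Lemma Ivar_linear_form f A : is_linsub A -> is_linear_form_of f A ->
  eqset (Ivar A) (igen ringR (fun p => p = f)).
Proof.
move=> /andP[rA rA'] [fh fA].
(* If all coefficients were zero, [f] would vanish at every vector and [A] would have full rank. *)
have [a ca] : exists a, f@_U_(a) != 0.
  apply/existsP; apply: contraLR rA'; rewrite negb_exists -leqNgt.
  move/forallP => c0.
  suff /mxrankS : (1%:M <= A)%MS by rewrite mxrank1.
  apply/row_subP => i; apply/fA; rewrite meval_dhomog1 // big1 // => j _.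
  by have := c0 j; rewrite negbK => /eqP ->; rewrite mul0r.
set c := f@_U_(a) in ca.
pose P : 'M[K]_n.+1 :=
  \matrix_(j, i) ((i == j)%:R - f@_U_(j) * (i == a)%:R / c).
(* Hence the only nonzero generator x_i - (xP)_i of the ideal is the one for i = a, and it equals f
   / c. *)
have linP i : lin P i = 'X_i - ((i == a)%:R / c) *: f.
  rewrite {1}(dhomog1E fh) /lin scaler_sumr.
  under eq_bigr => j _ do rewrite mxE scalerBl.
  rewrite sumrB; congr (_ - _); last first.
    by apply: eq_bigr => j _; rewrite scalerA -mulrA mulrC.
  rewrite (bigD1 i) //= eqxx scale1r big1 ?addr0 // => j ji.
  by rewrite eq_sym (negPf ji) scale0r.
have HP : is_proj A P.
  split; first apply/row_subP => j.
    apply/fA; rewrite meval_dhomog1 //.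
    under eq_bigr => i _ do rewrite !mxE mulrBr.
    rewrite sumrB (bigD1 j) //= big1 ?addr0 => [|i /negPf ->]; last first.
      by rewrite mulr0.
    rewrite (bigD1 a) //= big1 ?addr0 => [|i /negPf ->]; last first.
      by rewrite mulr0 mul0r mulr0.
    by rewrite !eqxx !mulr1 mulrCA divff // mulr1 subrr.
  (* The rows of [A] are fixed by [P] because [f] vanishes on them. *)
  apply/row_matrixP => i; rewrite row_mul; apply/rowP => j.
  have := (fA (row i A)).1 (row_sub _ _); rewrite meval_dhomog1 // => fv.
  rewrite mxE; under eq_bigr => b _ do rewrite [P _ _]mxE mulrBr.
  rewrite sumrB (bigD1 j) //= eqxx mulr1 big1 ?addr0 => [|b bj]; last first.
    by rewrite eq_sym (negPf bj) mulr0.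
  rewrite (eq_bigr (fun b => (f@_U_(b) * row i A 0 b) * ((j == a)%:R / c))).
    by rewrite -mulr_suml fv mul0r subr0.
  by move=> b _; rewrite !mulrA [f@_ _ * _]mulrC.
move=> p; split=> [/(Ivar_igen rA HP)|]; apply: igen_sub.
- exact: igen_ideal.
- move=> _ [i ->]; rewrite linP opprB addrC subrK.
  by apply: (idealZ (@subalg_ringR K n)); [apply: igen_ideal | apply: igen_in].
- exact: igen_ideal.
move=> _ ->; have := Ivar_gen_sub a HP; rewrite linP eqxx opprB addrC subrK.
have HI : ideal_of ringR (Ivar A) by apply: igen_ideal.
move/(idealZ (@subalg_ringR K n) HI c).
by rewrite scalerA div1r divff // scale1r.
Qed.

Lemma ipow_principal f m p :
  ipow ringR (igen ringR (fun p => p = f)) m p -> exists q, p = f ^+ m * q.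
Proof.
pose E m p := exists q, p = f ^+ m * q.
apply: (@ipow_ind _ _ ringR _ E) => //.
- by move=> {}p _; exists p; rewrite expr0 mul1r.
- move=> {}m; split=> [|_ _ [u ->] [v ->]|u _ _ [v ->]].
  + by exists 0; rewrite mulr0.
  + by exists (u + v); rewrite mulrDr.
  + by exists (u * v); rewrite mulrCA.
- move=> {}m _ q [N [a [g [H ->]]]] [u ->].
  exists ((\sum_i a i) * u); rewrite exprS mulrACA [f * _]mulr_sumr.
  by congr (_ * _); apply: eq_bigr => i _; have [_ ->] := H i; rewrite mulrC.
Qed.

Lemma ipow_Ivar_cancel_prod (T : eqType) (r : seq T) (e : T -> R) (h : T -> nat)
    A m q :
  (0 < \rank A)%N -> {in r, forall i, ~ Ivar A (e i)} ->
  ipow ringR (Ivar A) m ((\prod_(i <- r) e i ^+ h i) * q) ->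
  ipow ringR (Ivar A) m q.
Proof.
move=> rA; elim: r => [|i r IH] Ie; first by rewrite big_nil mul1r.
rewrite big_cons -mulrA => /(ipow_Ivar_cancelX rA (Ie i (mem_head _ _))).
by apply: IH => j jr; apply: Ie; rewrite in_cons jr orbT.
Qed.

(** Induction on the list. Once p is divided by the factors for [r], these can be cancelled modulo
    I_(H_i)^(h_i), as none of their forms lies in I_(H_i); so the quotient is in the principal ideal
    (e_i^(h_i)). *)
Lemma dvd_prod_linear_forms (T : eqType) (r : seq T) (e : T -> R)
    (h : T -> nat) (H : T -> 'M[K]_n.+1) p : uniq r ->
  (forall i, is_linsub (H i)) -> (forall i, is_linear_form_of (e i) (H i)) ->
  (forall i j, i != j -> ~ Ivar (H i) (e j)) ->
  {in r, forall i, ipow ringR (Ivar (H i)) (h i) p} ->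
  exists q, p = (\prod_(i <- r) e i ^+ h i) * q.
Proof.
move=> ur Hlin He Hij; elim: r ur => [|i r IH] /=.
  by exists p; rewrite big_nil mul1r.
case/andP=> ir ur Hp.
have [|q Eq] := IH ur.
  by move=> j jr; apply: Hp; rewrite in_cons jr orbT.
have Hq : ipow ringR (Ivar (H i)) (h i) q.
  have /andP[rA _] := Hlin i.
  apply: (@ipow_Ivar_cancel_prod _ r e h) => //.
    by move=> j jr; apply: Hij; apply: contraNneq ir => ->.
  by rewrite -Eq; apply/Hp/mem_head.
have /ipow_principal[u Eu] :=
  (eq_ipow _ (Ivar_linear_form (Hlin i) (He i)) q).1 Hq.
rewrite Eq Eu.
by exists u; rewrite big_cons mulrCA mulrA.
Qed.

End LinearForms.

(** * Coefficients in x_0 *)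

(* A form as a polynomial in T = x_0 with coefficients in R'. *)
HB.lock Definition xco (K : fieldType) (n : nat) :
    {mpoly K[n.+1]} -> {poly {mpoly K[n.+1]}} :=
  mmap (polyC \o @mpolyC _ _)
       (fun i => if i == ord0 then 'X else ('X_i)%:P).

Section Coefficients.
Variables (K : fieldType) (n : nat).
Local Notation R := {mpoly K[n.+1]}.
Implicit Types (p q f g : R) (A : 'M[K]_n.+1) (I : R -> Prop).
Local Notation x0 := (@xvar0 K n).

Lemma xcoC c : xco (c%:MP : R) = (c%:MP)%:P.
Proof. by rewrite xco.unlock mmapC. Qed.

Lemma xcoX i : xco ('X_i : R) = if i == ord0 then 'X else ('X_i)%:P.
Proof. by rewrite xco.unlock mmapX mmap1U. Qed.

Lemma xcoD : {morph @xco K n : p q / p + q}.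
Proof. by rewrite xco.unlock; apply: rmorphD. Qed.

Lemma xcoM : {morph @xco K n : p q / p * q}.
Proof. by rewrite xco.unlock; apply: rmorphM. Qed.

Lemma xco0 : xco (0 : R) = 0.
Proof. by rewrite -mpolyC0 xcoC. Qed.

Lemma xcoZ c p : xco (c *: p) = (c%:MP)%:P * xco p.
Proof. by rewrite -mul_mpolyC xcoM xcoC. Qed.

Lemma xco_sum (T : Type) (r : seq T) (P : pred T) (F : T -> R) :
  xco (\sum_(i <- r | P i) F i) = \sum_(i <- r | P i) xco (F i).
Proof. exact: (big_morph _ xcoD xco0). Qed.

Lemma xco_x0X j : xco (x0 ^+ j) = 'X^j.
Proof.
elim: j => [|j IH]; first by rewrite !expr0 -mpolyC1 xcoC.
by rewrite !exprS xcoM IH xcoX eqxx.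
Qed.

Lemma xco_at p : (xco p).[x0] = p.
Proof.
elim/mpoly_alg_ind: p => [c|p q Ep Eq|p q Ep Eq|i].
- by rewrite xcoC hornerC.
- by rewrite xcoD hornerD Ep Eq.
- by rewrite xcoM hornerM Ep Eq.
- by rewrite xcoX; case: eqP => [->|_]; rewrite (hornerX, hornerC).
Qed.

Lemma xcoE p : p = \sum_(j < size (xco p)) x0 ^+ j * (xco p)`_j.
Proof.
rewrite -{1}(xco_at p) horner_coef.
by apply: eq_bigr => j _; rewrite mulrC.
Qed.

Lemma xco_inj : injective (@xco K n).
Proof. by move=> p q E; rewrite -(xco_at p) E xco_at. Qed.

Lemma xco_ringR' p j : ringR' (xco p)`_j.
Proof.
have HS := @subalg_ringR' K n; have [SC SD SM] := HS.
have [S0 _ _] := subalg_ideal HS.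
elim/mpoly_alg_ind: p j => [c|p q Ep Eq|p q Ep Eq|i] j.
- by rewrite xcoC coefC; case: eqP.
- by rewrite xcoD coefD; apply: SD; [apply: Ep|apply: Eq].
- rewrite xcoM coefM; apply: (ideal_sum _ (subalg_ideal HS)) => i _.
  by apply: SM; [apply: Ep|apply: Eq].
- rewrite xcoX; case: ifPn => [_|i0].
    by rewrite coefX; case: eqP => _ //; rewrite mulr1n -mpolyC1.
  by rewrite coefC; case: eqP => _ //; apply: ringR'_X.
Qed.

Lemma xco_id p : ringR' p -> xco p = p%:P.
Proof.
move=> Hp; rewrite [in LHS](mpolyE p) [in RHS](mpolyE p) xco_sum rmorph_sum /=.
apply: eq_big_seq => m /Hp m0; rewrite xcoZ -mul_mpolyC rmorphM.
congr (_ * _); rewrite xco.unlock mmapX mpolyXE_id rmorph_prod /=.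
apply: eq_bigr => i _; rewrite rmorphXn /=; case: eqP => // ->.
by rewrite m0 !expr0.
Qed.

Lemma xco_id0 p : ringR' p -> (xco p)`_0 = p.
Proof. by move=> Hp; rewrite xco_id // coefC. Qed.

Lemma xco_x0M j p : xco (x0 ^+ j * p) = 'X^j * xco p.
Proof. by rewrite xcoM xco_x0X. Qed.

(** The difference of p and its constant coefficient is a multiple of x_0. *)
Lemma xco_coef0_ideal I p : ideal_of ringR I -> I x0 -> I p -> I (xco p)`_0.
Proof.
move=> HI Ix Ip; rewrite -[_`_0](subKr p).
apply: (idealB (@subalg_ringR K n) HI) => //.
rewrite -{1}(xco_at p); have [I0 _ IM] := HI.
elim/poly_ind: (xco p) => [|g c _]; first by rewrite horner0 coef0 subrr.
rewrite hornerMXaddC coefD coefMX coefC add0r addrK.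
exact: IM.
Qed.

(** Each factor x_0 accounts for one factor from I_V. For j >= m the truncated difference is 0 and
    the condition is void, since I^0 = R. *)
Lemma ipow_x0_coefP A m p : Ivar A x0 ->
  ipow ringR (Ivar A) m p <->
  forall j, ipow ringR (Ivar A) (m - j) (xco p)`_j.
Proof.
move=> Ix; have HI e := ipow_ideal (Ivar A) e (@subalg_ringR K n); split.
  pose E m p := forall j, ipow ringR (Ivar A) (m - j) (xco p)`_j.
  apply: (@ipow_ind _ _ ringR (Ivar A) E) => // [{}m|{}m f q If Eq].
    split=> [j|f q Ef Eq j|f q _ Eq j]; have [I0 ID IM] := HI (m - j)%N.
    - by rewrite xco0 coef0.
    - by rewrite xcoD coefD; apply: ID; [apply: Ef|apply: Eq].
    - rewrite xcoM coefM; apply: (ideal_sum _ (HI _)) => i _; apply: IM => //.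
      by apply: ipow_anti_ringR (Eq _); apply: leq_sub2l; apply: leq_subr.
  (* In the sum of the f_i q_(j-i), the term i = 0 gains a power of I from f_0, and a term with i >
     0 from the smaller index of q_(j-i). For j > m, [(m - j).+1] is larger than [m.+1 - j], so only
     an inequality between them is available. *)
  move=> j; rewrite xcoM coefM; apply: (ideal_sum _ (HI _)) => -[i ltij] _ /=.
  case: i ltij => [|i] ltij.
    rewrite subn0; apply: (@ipow_anti_ringR _ _ _ _ (m - j).+1).
      by lia.
    apply: ipowSM => //; apply: xco_coef0_ideal => //; exact: igen_ideal.
  have [_ _ IM] := HI (m.+1 - j)%N; apply: IM => //.
  by apply: ipow_anti_ringR (Eq _); lia.
(* Conversely x_0^j lies in I^j, and j + (m - j) >= m holds also with truncated subtraction. *)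
move=> Hp; rewrite (xcoE p); apply: (ideal_sum _ (HI m)) => j _.
apply: (@ipow_anti_ringR _ _ _ _ (j + (m - j))); first by lia.
by apply: ipowM => //; apply: ipow_exp.
Qed.

(** Generators in R' are constant as polynomials in x_0, so an element of the ideal has all its
    x_0-coefficients in the ideal. *)
Lemma ipow_R'_coefP (G : R -> Prop) m p : (forall q, G q -> ringR' q) ->
  ipow ringR (igen ringR G) m p <->
  forall j, ipow ringR (igen ringR G) m (xco p)`_j.
Proof.
move=> GR'; set I := igen _ _.
have HI e := ipow_ideal I e (@subalg_ringR K n).
have coefI f : I f -> forall j, I (xco f)`_j.
  have HG : ideal_of ringR I by apply: igen_ideal.
  have [I0 ID IM] := HG.
  apply: (@igen_sub _ _ ringR G (fun f => forall j, I (xco f)`_j)).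
    split=> [j|u v Hu Hv j|u v _ Hv j].
    - by rewrite xco0 coef0.
    - by rewrite xcoD coefD; apply: ID; [apply: Hu|apply: Hv].
    - by rewrite xcoM coefM; apply: (ideal_sum _ HG) => i _; apply: IM.
  move=> u Gu j; rewrite (xco_id (GR' _ Gu)) coefC; case: eqP => _ //.
  exact: igen_in.
split.
  pose E m p := forall j, ipow ringR I m (xco p)`_j.
  apply: (@ipow_ind _ _ ringR I E) => // [{}m|{}m f q If Eq j].
    split=> [j|f q Ef Eq j|f q _ Eq j]; have [I0 ID IM] := HI m.
    - by rewrite xco0 coef0.
    - by rewrite xcoD coefD; apply: ID; [apply: Ef|apply: Eq].
    - by rewrite xcoM coefM; apply: (ideal_sum _ (HI _)) => i _; apply: IM.
  rewrite xcoM coefM; apply: (ideal_sum _ (HI _)) => i _.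
  by apply: ipowSM => //; apply: coefI.
move=> Hp; rewrite (xcoE p); apply: (ideal_sum _ (HI m)) => j _.
by have [_ _ IM] := HI m; apply: IM.
Qed.

(** Setting x_0 = 0, that is, taking the constant coefficient of [xco], is a ring retraction of R
    onto R' fixing [G]; it carries powers of the ideal generated in R back to powers of the one
    generated in R'. *)
Lemma ipow_ringR'P (G : R -> Prop) m p : (forall q, G q -> ringR' q) ->
  ringR' p ->
  ipow ringR (igen ringR G) m p <-> ipow ringR' (igen ringR' G) m p.
Proof.
move=> GR' pR'; have HS := @subalg_ringR' K n.
have subG q : igen ringR' G q -> igen ringR G q.
  apply: (@igen_sub _ _ ringR'); last by move=> u Gu; apply: igen_in.
  have [I0 ID IM] := @igen_ideal K n _ G (@subalg_ringR K n).
  by split=> // u v _; apply: IM.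
split; last by apply: ipow_mono.
have coefI f : igen ringR G f -> igen ringR' G (xco f)`_0.
  have [I0 ID IM] := @igen_ideal K n _ G HS.
  apply: (@igen_sub _ _ ringR G (fun f => igen ringR' G (xco f)`_0)).
    split=> [|u v Hu Hv|u v _ Hv].
    - by rewrite xco0 coef0.
    - by rewrite xcoD coefD; apply: ID.
    - by rewrite xcoM coef0M; apply: IM => //; apply: xco_ringR'.
  by move=> u Gu; rewrite (xco_id0 (GR' _ Gu)); apply: igen_in.
rewrite -{2}(xco_id0 pR').
pose E m p := ipow ringR' (igen ringR' G) m (xco p)`_0.
apply: (@ipow_ind _ _ ringR _ E) => // [q _|{}m|{}m f q If Eq].
- exact: xco_ringR'.
- have [I0 ID IM] := ipow_ideal (igen ringR' G) m HS.
  rewrite /E; split=> [|u v Hu Hv|u v _ Hv].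
  - by rewrite xco0 coef0.
  - by rewrite xcoD coefD; apply: ID.
  - by rewrite xcoM coef0M; apply: IM => //; apply: xco_ringR'.
- by rewrite /E xcoM coef0M; apply: ipowSM => //; apply: coefI.
Qed.

End Coefficients.

(** * Graded decompositions *)

Section Graded.
Variables (K : fieldType) (n : nat).
Local Notation R := {mpoly K[n.+1]}.
Implicit Types (p q f g : R) (I : R -> Prop) (P : pred nat).
Local Notation x0 := (@xvar0 K n).

Definition subspace I : Prop :=
  [/\ I 0, forall p q, I p -> I q -> I (p + q)
    & forall c p, I p -> I (c *: p)].

Lemma ideal_subspace S I : subalg S -> ideal_of S I -> subspace I.
Proof. by move=> HS HI; have [I0 ID _] := HI; split=> //; apply: idealZ HI. Qed.

Lemma subspace_meet I J : subspace I -> subspace J -> subspace (meet I J).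
Proof.
move=> [I0 ID IZ] [J0 JD JZ]; split=> // [p q [Ip Jp] [Iq Jq]|c p [Ip Jp]].
  by split; [apply: ID|apply: JD].
by split; [apply: IZ|apply: JZ].
Qed.

Lemma subspace_scale f I : subspace I -> subspace (scale_set f I).
Proof.
move=> [I0 ID IZ]; split.
- by exists 0 => //; rewrite mulr0.
- move=> _ _ [p Ip ->] [q Iq ->]; exists (p + q); first exact: ID.
  by rewrite mulrDr.
- move=> c _ [p Ip ->]; exists (c *: p); first exact: IZ.
  by rewrite scalerAr.
Qed.

(** The sum of the x_0^j J_j when every J_j is a subspace of R', expressed through coefficients so
    that membership can be tested one j at a time. *)
Definition xgraded (J : nat -> R -> Prop) : R -> Prop :=
  fun p => forall j, J j (xco p)`_j.

Variable J : nat -> R -> Prop.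
Hypotheses (HJ : forall j, subspace (J j))
  (JR' : forall j p, J j p -> ringR' p).
Let F j := scale_set (x0 ^+ j) (J j).

Lemma xgraded_subspace : subspace (xgraded J).
Proof.
split=> [j|p q Hp Hq j|c p Hp j]; have [J0 JD JZ] := HJ j.
- by rewrite xco0 coef0.
- by rewrite xcoD coefD; apply: JD; [apply: Hp|apply: Hq].
- by rewrite xcoZ coefCM mul_mpolyC; apply: JZ.
Qed.

Lemma xco_scaled j p i : F j p -> (xco p)`_i = if i == j then (xco p)`_j else 0.
Proof.
case=> q /JR' qR' ->; rewrite xco_x0M xco_id // !coefXnM ltnn subnn !coefC eqxx.
by case: ltngtP => // [ltji|->]; rewrite ?subnn // subn_eq0 leqNgt ltji.
Qed.

Lemma xco_scaledP j p : F j p -> p = x0 ^+ j * (xco p)`_j /\ J j (xco p)`_j.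
Proof.
case=> q Jq ->; have /xco_id0 qR' := JR' Jq.
by rewrite xco_x0M coefXnM ltnn subnn qR'.
Qed.

Lemma xco_sum_scaled P N (f : nat -> R) i :
  (forall j, (j < N)%N -> P j -> F j (f j)) ->
  (xco (\sum_(j < N | P j) f j))`_i =
  if (i < N)%N && P i then (xco (f i))`_i else 0.
Proof.
move=> Ff; rewrite xco_sum coef_sum.
transitivity (\sum_(j < N | P j && (j == i :> nat)) (xco (f j))`_i).
  rewrite big_mkcondr; apply: eq_bigr => j Pj.
  by rewrite (xco_scaled _ (Ff j (ltn_ord j) Pj)) eq_sym; case: eqP => // ->.
have [ltiN|leNi] := ltnP i N; last first.
  rewrite big1 // => j /andP[_ /eqP ji].
  by have := ltn_ord j; rewrite ji ltnNge leNi.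
have [Pi|nPi] := boolP (P i); last first.
  by rewrite big1 // => j /andP[Pj /eqP ji]; rewrite -ji Pj in nPi.
rewrite (big_pred1 (Ordinal ltiN)) // => j; rewrite /= -val_eqE /=.
by case: eqP => [->|_]; rewrite ?Pi ?andbF.
Qed.

(** The expansion of p in powers of x_0 with coefficients in R' is unique, so the j-th summand is
    forced. *)
Lemma sum_setP P p :
  sum_set P F p <-> forall j, if P j then J j (xco p)`_j else (xco p)`_j = 0.
Proof.
split=> [[N [f [Ff ->]]] j|Hp].
  rewrite xco_sum_scaled //.
  have [Pj|nPj] := boolP (P j); rewrite (andbT, andbF) //.
  have [ltjN|_] := ltnP j N; last by case: (HJ j).
  by have [] := xco_scaledP (Ff j ltjN Pj).
exists (size (xco p)), (fun j => x0 ^+ j * (xco p)`_j); split=> [j _ Pj|].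
  by exists (xco p)`_j => //; have := Hp j; rewrite Pj.
rewrite [LHS]xcoE (bigID (fun j : 'I_ _ => P j)) /= [X in _ + X]big1 ?addr0 //.
by move=> j /negPf Pj; have := Hp j; rewrite Pj => ->; rewrite mulr0.
Qed.

Lemma sum_is_direct_scaled P : sum_is_direct P F.
Proof.
move=> N f Ff sum0 j ltjN Pj; have [-> _] := xco_scaledP (Ff j ltjN Pj).
have := xco_sum_scaled j Ff; rewrite sum0 xco0 coef0 ltjN Pj /= => <-.
by rewrite mulr0.
Qed.

Lemma is_direct_sum_xgraded : is_direct_sum (xgraded J) xpredT F.
Proof.
by split; [move=> p; rewrite sum_setP | apply: sum_is_direct_scaled].
Qed.

(** The tail may be written with another family that agrees with [F] from index b on; this
    accommodates the summands x_0^j I_Z'. *)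
Lemma is_direct_sum2_split b (F' : nat -> R -> Prop) :
  (forall j, (b <= j)%N -> eqset (F' j) (F j)) ->
  is_direct_sum2 (xgraded J) (sum_set (fun j => (j < b)%N) F)
    (sum_set (fun j => (b <= j)%N) F').
Proof.
move=> FF'.
have eqF p : sum_set (fun j => (b <= j)%N) F' p <->
             sum_set (fun j => (b <= j)%N) F p.
  by split=> -[N [f [Ff ->]]]; exists N, f; split=> // j ltj lebj;
    apply/FF' => //; apply: Ff.
split=> [p|p1 p2 /sum_setP H1 /eqF/sum_setP H2 p12].
  split=> [Hp|[p1 [p2 [/sum_setP H1 /eqF/sum_setP H2 ->]]] j].
    pose f j := x0 ^+ j * (xco p)`_j.
    have Ff j : F j (f j) by exists (xco p)`_j.
    exists (\sum_(j < size (xco p) | (j < b)%N) f j),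
      (\sum_(j < size (xco p) | (b <= j)%N) f j); split.
    - by exists (size (xco p)), f.
    - by apply/eqF; exists (size (xco p)), f.
    rewrite {1}(xcoE p) (bigID (fun j : 'I_ _ => (j < b)%N)) /=.
    by congr (_ + _); apply: eq_bigl => j; rewrite -leqNgt.
  rewrite xcoD coefD; have := H1 j; have := H2 j.
  by case: ltnP => _ => [-> ?|? ->]; rewrite ?addr0 ?add0r.
have p1j j : (xco p1)`_j = 0.
  have := congr1 (fun p => (xco p)`_j) p12; rewrite xcoD coefD xco0 coef0.
  have := H1 j; have := H2 j.
  by case: ltnP => _ => [-> ?|? -> //]; rewrite addr0.
have p10 : p1 = 0.
  by apply: xco_inj; rewrite xco0; apply/polyP => j; rewrite p1j coef0.
by split=> //; rewrite p10 add0r in p12.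
Qed.

End Graded.

Section Shift.
Variables (K : fieldType) (n : nat).
Local Notation R := {mpoly K[n.+1]}.
Local Notation x0 := (@xvar0 K n).
Variable J : nat -> R -> Prop.
Hypotheses (HJ : forall j, subspace (J j))
  (JR' : forall j p, J j p -> ringR' p).

Lemma xgraded_shiftP b p :
  scale_set (x0 ^+ b) (xgraded (fun j => J (b + j))) p <->
  sum_set (fun j => (b <= j)%N) (fun j => scale_set (x0 ^+ j) (J j)) p.
Proof.
rewrite (sum_setP HJ JR'); split=> [[q Hq ->] j|Hp].
  rewrite xco_x0M coefXnM ltnNge; case: leqP => //= lebj.
  by have := Hq (j - b)%N; rewrite subnKC.
(* [q] is p divided by x_0^b, possible because the coefficients below index b vanish. *)
pose q := \sum_(i < size (xco p) | (b <= i)%N) x0 ^+ (i - b) * (xco p)`_i.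
have Ep : p = x0 ^+ b * q.
  rewrite [LHS]xcoE (bigID (fun j : 'I_ _ => (b <= j)%N)) /=.
  rewrite [X in _ + X]big1 ?addr0; last first.
    by move=> i /negPf ltib; have := Hp i; rewrite ltib => ->; rewrite mulr0.
  rewrite mulr_sumr; apply: eq_bigr => i lebi.
  by rewrite mulrA -exprD subnKC.
exists q => // j; have := Hp (b + j)%N; rewrite leq_addr Ep xco_x0M coefXnM.
by rewrite ltnNge leq_addr addKn.
Qed.

Lemma is_direct_sum2_shift b I :
  eqset I (xgraded (fun j => J (b + j))) ->
  is_direct_sum2 (xgraded J)
    (sum_set (fun j => (j < b)%N) (fun j => scale_set (x0 ^+ j) (J j)))
    (scale_set (x0 ^+ b) I).
Proof.
move=> HI.
have E p : scale_set (x0 ^+ b) I p <->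
    sum_set (fun j => (b <= j)%N) (fun j => scale_set (x0 ^+ j) (J j)) p.
  rewrite -xgraded_shiftP.
  by split=> -[q Hq ->]; exists q => //; apply/HI.
have [D1 D2] := is_direct_sum2_split HJ JR' (b := b) (fun j _ p => iff_refl _).
split=> [p|p1 p2 H1 /E]; last exact: D2.
rewrite D1; split=> -[p1 [p2 [H1 H2 ->]]]; exists p1, p2; split=> //; exact/E.
Qed.

End Shift.

(** * Hilbert functions *)

(** A subspace of maximal dimension among those inside [Q] contains every v in [Q], since adding the
    line of v cannot enlarge it. *)
Lemma ex_vspace (K : fieldType) (V : vectType K) (Q : V -> Prop) :
  Q 0 -> (forall u v, Q u -> Q v -> Q (u + v)) ->
  (forall c u, Q u -> Q (c *: u)) ->
  exists U : {vspace V}, forall v, v \in U <-> Q v.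
Proof.
move=> Q0 QD QZ.
pose sub d := exists U : {vspace V}, (forall v, v \in U -> Q v) /\ \dim U = d.
(* Classical decision of [sub], as a maximum is taken over a boolean predicate. *)
pose subb d : bool := excluded_middle_informative (sub d).
have subP d : subb d <-> sub d.
  by rewrite /subb; case: (excluded_middle_informative _).
have sub0 : exists d, subb d.
  exists 0%N; apply/subP; exists 0%VS; rewrite dimv0; split=> // v.
  by rewrite memv0 => /eqP ->.
have ub d : subb d -> (d <= \dim {:V})%N.
  by case/subP => U [_ <-]; apply/dimvS/subvf.
case: (ex_maxnP sub0 ub) => _ /subP[U [UQ <-]] Umax.
exists U => v; split; first exact: UQ.
move=> Qv; have : subb (\dim (U + <[v]>)).
  apply/subP; exists (U + <[v]>)%VS; split=> // x.
  case/memv_addP => u uU [w /vlineP[c ->] ->].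
  by apply: QD; [apply: UQ | apply: QZ].
move/Umax => dimU.
have : (U == U + <[v]>)%VS by rewrite eqEdim addvSl.
by move/eqP->; rewrite memvE addvSr.
Qed.

Lemma dim_linear_inj (K : fieldType) (V W : vectType K) (U : {vspace V})
    (U' : {vspace W}) (g : V -> W) :
  linear g -> injective g -> (forall v, v \in U -> g v \in U') ->
  (forall w, w \in U' -> exists2 v, v \in U & w = g v) -> \dim U = \dim U'.
Proof.
move=> glin ginj gU gU'.
pose G : {linear V -> W} := HB.pack g (GRing.isLinear.Build K V W *:%R g glin).
have GE v : linfun G v = g v by rewrite lfunE.
rewrite -(@limg_dim_eq _ _ _ (linfun G) U).
  congr (\dim _); apply/vspaceP => w; apply/memv_imgP/idP.
    by case=> v vU ->; rewrite GE; apply: gU.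
  by case/gU' => v vU ->; exists v; rewrite ?GE.
apply/eqP; rewrite -subv0; apply/subvP => v /memv_capP[_].
rewrite memv_ker GE memv0 => /eqP gv0; apply/eqP/ginj.
by rewrite gv0 -(GE 0) linear0.
Qed.

Section Hilbert.
Variables (K : fieldType) (n : nat).
Local Notation R := {mpoly K[n.+1]}.
Implicit Types (p q f g : R) (I J : R -> Prop) (d e : nat) (t : int).
Local Notation x0 := (@xvar0 K n).

(** The property from which [epsilon] chooses is satisfiable by [ex_vspace]. *)
Lemma forms_ofP J d (p : dhomog n.+1 K d) : subspace J ->
  p \in forms_of J d <-> J (val p).
Proof.
move=> [J0 JD JZ].
pose Q (U : {vspace dhomog n.+1 K d}) :=
  forall p : dhomog _ _ _, p \in U <-> J (val p).
suff : Q (forms_of J d) by apply.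
apply: (epsilon_spec (inhabits 0%VS) Q).
by apply: ex_vspace => // [u v|c u]; [apply: JD | apply: JZ].
Qed.

Lemma hilb_neg J t : (t < 0)%R -> hilb J t = 0%N.
Proof. by case: t. Qed.

Lemma hilb_eq0 J d : subspace J ->
  (forall p, p \is d.-homog -> J p -> p = 0) -> hilb J d = 0%N.
Proof.
move=> HJ H; apply/eqP; rewrite /= dimv_eq0 -subv0; apply/subvP => p.
move/(forms_ofP _ HJ) => Jp; rewrite memv0; apply/eqP/val_inj.
by apply: H => //; apply: dhomog_is_dhomog.
Qed.

Lemma eq_hilb I J t : subspace I -> subspace J -> eqset I J ->
  hilb I t = hilb J t.
Proof.
move=> HI HJ IJ; case: t => // d /=; congr (\dim _); apply/vspaceP => p.
by apply/idP/idP => /forms_ofP H; apply/forms_ofP => //; apply/IJ/H.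
Qed.

Lemma dhomog_mul_cancel f p e d : f != 0 -> f \is e.-homog ->
  f * p \is (e + d).-homog -> p \is d.-homog.
Proof.
move=> f0 fh fph; pose c i := pihomog mdeg i p.
have ch i : c i \is i.-homog by apply: pihomogP.
suff -> : p = c d by [].
apply: (mulfI f0); rewrite -(pihomog_dE fph).
(* The bound is the maximum of [msize p] and [d.+1] so that the component of degree d is among the
   summands even if p has smaller degree. *)
rewrite {1}(pihomog_partitionE (leq_maxl (msize p) d.+1)).
rewrite mulr_sumr raddf_sum (bigD1 (Ordinal (leq_maxr (msize p) d.+1))) //=.
rewrite (pihomog_dE (dhomogM fh (ch d))) big1 ?addr0 // => i id.
by apply: (pihomog_ne0 _ (dhomogM fh (ch i))); rewrite eqn_add2l.
Qed.

(** Multiplication by f maps the forms of degree d in [J] bijectively onto those of degree e + d in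
    fJ; a form divisible by f has a homogeneous quotient. *)
Lemma hilb_scale f e J t : f != 0 -> f \is e.-homog -> subspace J ->
  hilb (scale_set f J) t = hilb J (t - e%:Z).
Proof.
move=> f0 fh HJ; have HfJ := subspace_scale f HJ.
case: t => [d|a]; last by rewrite [RHS]hilb_neg //; lia.
(* Below degree e there is nothing to count: leading monomials show that a nonzero multiple of f
   which is a form has degree at least e. *)
have [leed|ltde] := leqP e d; last first.
    rewrite [RHS]hilb_neg ?subr_lt0 //; apply: hilb_eq0 => // p ph [q Jq E].
    have [->|p0] := eqVneq p 0 => //.
    have q0 : q != 0 by apply: contraNneq p0 => q0; rewrite E q0 mulr0.
    move/dhomogP: ph => /(_ _ (mlead_supp p0)); rewrite E mleadM //= mdegD.
    move/dhomogP: fh => /(_ _ (mlead_supp f0)) /= -> Ed.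
    by rewrite -Ed ltnNge leq_addr in ltde.
  have [d' ->] : exists d', d = (e + d')%N by exists (d - e)%N; rewrite subnKC.
  rewrite PoszD [e%:Z + _]addrC addrK -PoszD addnC /= {d leed}.
  move: d' => d.
  pose g (p : dhomog n.+1 K d) : dhomog n.+1 K (e + d) :=
    DHomog (dhomogM fh (dhomog_is_dhomog p)).
  symmetry; apply: (dim_linear_inj (g := g)).
  - by move=> c p q; apply: val_inj; rewrite /= mulrDr scalerAr.
  - by move=> p q /(congr1 val) /= /(mulfI f0) /val_inj.
  - by move=> p /(forms_ofP _ HJ) Jp; apply/forms_ofP => //; exists (val p).
  move=> p /(forms_ofP _ HfJ) [q Jq E].
  have qh : q \is d.-homog.
    by apply: (dhomog_mul_cancel f0 fh); rewrite -E; apply: dhomog_is_dhomog.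
  exists (DHomog qh); first exact/forms_ofP.
  exact: val_inj.
Qed.

Lemma hilb_direct_sum J J1 J2 d : subspace J -> subspace J1 -> subspace J2 ->
  (forall p, J1 p -> J p) -> (forall p, J2 p -> J p) ->
  (forall p, J1 p -> J2 p -> p = 0) ->
  (forall p, p \is d.-homog -> J p ->
     exists p1 p2, [/\ p1 \is d.-homog, J1 p1, J2 p2 & p = p1 + p2]) ->
  hilb J d = (hilb J1 d + hilb J2 d)%N.
Proof.
move=> HJ HJ1 HJ2 J1J J2J J12 Jsum /=.
rewrite -dimv_disjoint_sum; last first.
  apply/eqP; rewrite -subv0; apply/subvP => p /memv_capP[].
  move=> /(forms_ofP _ HJ1) J1p /(forms_ofP _ HJ2) J2p.
  by rewrite memv0; apply/eqP/val_inj/J12.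
congr (\dim _); apply/vspaceP => p; apply/idP/memv_addP.
  move/(forms_ofP _ HJ) /(Jsum _ (dhomog_is_dhomog p)).
  case=> [p1 [p2 [p1h Jp1 Jp2 Ep]]].
  have p2h : p2 \is d.-homog.
    by rewrite -(addKr p1 p2) -Ep addrC rpredB // dhomog_is_dhomog.
  exists (DHomog p1h); first exact/forms_ofP.
  exists (DHomog p2h); first exact/forms_ofP.
  exact: val_inj.
have [J0 JD _] := HJ.
case=> p1 /(forms_ofP _ HJ1) Jp1 [p2 /(forms_ofP _ HJ2) Jp2 ->].
by apply/forms_ofP => //; apply: JD; [apply: J1J | apply: J2J].
Qed.

Lemma dhomog_mmap (h : 'I_n.+1 -> R) p d :
  (forall i, h i \is 1.-homog) -> p \is d.-homog ->
  mmap (@mpolyC _ _) h p \is d.-homog.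
Proof.
move=> hh /dhomogP ph; rewrite /mmap big_seq; apply: rpred_sum => m /ph <-.
rewrite mul_mpolyC; apply: rpredZ; rewrite /= mdegE.
apply: (big_rec2 (fun e g => g \is e.-homog)); first exact: dhomog1.
move=> i e g _ gh; apply: dhomogM => //.
by have := dhomogMn (m i) (hh i); rewrite mul1n.
Qed.

(** The constant coefficient is the substitution of 0 for x_0, and 0 counts as homogeneous of degree
    1. *)
Lemma dhomog_xco0 p d : p \is d.-homog -> (xco p)`_0 \is d.-homog.
Proof.
pose h (i : 'I_n.+1) : R := if i == ord0 then 0 else 'X_i.
have -> : (xco p)`_0 = mmap (@mpolyC _ _) h p.
  elim/mpoly_alg_ind: p => [c|p q Ep Eq|p q Ep Eq|i].
  - by rewrite xcoC coefC mmapC.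
  - by rewrite xcoD coefD Ep Eq mmapD.
  - by rewrite xcoM coef0M Ep Eq rmorphM.
  - rewrite xcoX mmapX mmap1U /h; case: eqP => _; first by rewrite coefX.
    by rewrite coefC.
apply: dhomog_mmap => i; rewrite /h; case: eqP => _; first exact: rpred0.
by rewrite dhomogX /= mdeg1.
Qed.

(** From p = p_0 + x_0 q, the space is J_0 plus x_0 times the space of the shifted family, the sum
    being direct in each degree. *)
Lemma hilb_xgradedS (J : nat -> R -> Prop) t :
  (forall j, subspace (J j)) -> (forall j p, J j p -> ringR' p) ->
  hilb (xgraded J) t =
  (hilb (J 0%N) t + hilb (xgraded (fun j => J j.+1)) (t - 1))%N.
Proof.
move=> HJ JR'; case: t => [d|m]; last by rewrite [X in (_ + X)%N]hilb_neg.
have HX := xgraded_subspace HJ.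
have HX1 : subspace (xgraded (fun j => J j.+1)) by apply: xgraded_subspace.
have x0n0 : x0 != 0.
  apply/eqP => /(congr1 (mcoeff U_(ord0))); rewrite mcoeffXU eqxx mcoeff0.
  by move/eqP; rewrite oner_eq0.
have x0h : x0 \is 1.-homog by rewrite dhomogX /= mdeg1.
rewrite -(hilb_scale _ x0n0 x0h HX1); apply: hilb_direct_sum => //.
- exact: subspace_scale.
- move=> p Jp j; rewrite (xco_id (JR' _ _ Jp)) coefC; case: eqP => [->//|_].
  by case: (HJ j).
- move=> _ [q Hq ->] j; rewrite -[x0]expr1 xco_x0M coefXnM.
  by case: j => [|j]; [case: (HJ 0%N) | rewrite subn1; apply: Hq].
- move=> p Jp [q Hq E]; rewrite -(xco_id0 (JR' _ _ Jp)) E -[x0]expr1 xco_x0M.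
  by rewrite coefXnM.
move=> p ph Hp; exists (xco p)`_0, (p - (xco p)`_0); split.
- exact: dhomog_xco0.
- exact: Hp.
- rewrite -[x0]expr1; apply/(xgraded_shiftP HJ JR' 1)/(sum_setP HJ JR') => j.
  rewrite -scaleN1r xcoD xcoZ coefD coefCM (xco_id (@xco_ringR' _ _ p 0)) coefC.
  case: j => [|j] /=; rewrite mul_mpolyC scaleN1r ?subrr // oppr0 addr0.
  exact: Hp.
- by rewrite addrC subrK.
Qed.

Lemma hilb_xgraded (J : nat -> R -> Prop) b t :
  (forall j, subspace (J j)) -> (forall j p, J j p -> ringR' p) ->
  hilb (xgraded J) t =
  (\sum_(j < b) hilb (J j) (t - j%:Z) +
   hilb (xgraded (fun j => J (b + j)%N)) (t - b%:Z))%N.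
Proof.
elim: b J t => [|b IH] J t HJ JR'; first by rewrite big_ord0 subr0.
rewrite hilb_xgradedS // IH //; last by move=> j; apply: JR'.
rewrite big_ord_recl subr0 addnA.
congr (_ + _ + _)%N; last by rewrite intS opprD addrA.
by apply: eq_bigr => j _; rewrite lift0 intS opprD addrA.
Qed.

End Hilbert.

(** * Counting monomials *)

Section MonomialCount.

Definition monos (N d : nat) : seq 'X_{1..N} :=
  [seq s2m t | t : d.-tuple 'I_N <- enum (basis N d)].

Lemma mem_monos N d m : (m \in monos N d) = (mdeg m == d).
Proof. by rewrite basis_cover. Qed.

Lemma uniq_monos N d : uniq (monos N d).
Proof. exact: uniq_basis. Qed.

Lemma size_monos N d : size (monos N.+1 d) = 'C(d + N, N).
Proof. by rewrite size_basis -bin_sub ?leq_addr // addKn. Qed.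

(** The degree in the tail variables x_(k+1), x_(k+2), ..., with variables numbered from 0. *)
Definition tdeg (N k : nat) (m : 'X_{1..N}) : nat :=
  (\sum_(i < N | k < i) m i)%N.

Lemma tdegD N k (m1 m2 : 'X_{1..N}) :
  tdeg k (m1 + m2) = (tdeg k m1 + tdeg k m2)%N.
Proof.
by rewrite /tdeg -big_split; apply: eq_bigr => i _; rewrite mnmDE.
Qed.

Lemma tdeg_le N k (m : 'X_{1..N}) : (tdeg k m <= mdeg m)%N.
Proof.
by rewrite mdegE /tdeg [leqRHS](bigID (fun i : 'I_N => k < i)%N) leq_addr.
Qed.

Definition mcat (a b : nat) (u : 'X_{1..a}) (v : 'X_{1..b}) : 'X_{1..a + b} :=
  [multinom match split i with inl j => u j | inr j => v j end | i < a + b].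

Lemma mcat_l a b (u : 'X_{1..a}) (v : 'X_{1..b}) i :
  mcat u v (lshift b i) = u i.
Proof. by rewrite mnmE (unsplitK (inl _ i)). Qed.

Lemma mcat_r a b (u : 'X_{1..a}) (v : 'X_{1..b}) i :
  mcat u v (rshift a i) = v i.
Proof. by rewrite mnmE (unsplitK (inr _ i)). Qed.

Lemma mcat_inj a b (x y : 'X_{1..a} * 'X_{1..b}) :
  mcat x.1 x.2 = mcat y.1 y.2 -> x = y.
Proof.
case: x y => u v [u' v'] /= /mnmP E; congr (_, _); apply/mnmP => i.
  by have := E (lshift b i); rewrite !mcat_l.
by have := E (rshift a i); rewrite !mcat_r.
Qed.

Lemma mdeg_mcat a b (u : 'X_{1..a}) (v : 'X_{1..b}) :
  mdeg (mcat u v) = (mdeg u + mdeg v)%N.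
Proof.
rewrite !mdegE big_split_ord /=; congr (_ + _)%N.
  by apply: eq_bigr => i _; rewrite mcat_l.
by apply: eq_bigr => i _; rewrite mcat_r.
Qed.

Lemma tdeg_mcat k b (u : 'X_{1..k.+1}) (v : 'X_{1..b}) :
  tdeg k (mcat u v) = mdeg v.
Proof.
rewrite /tdeg mdegE big_mkcond big_split_ord /= big1 ?add0n => [|i _].
  by apply: eq_bigr => i _; rewrite addSn ltnS leq_addr mcat_r.
by rewrite ltnNge -ltnS ltn_ord.
Qed.

Lemma mcat_surj a b (m : 'X_{1..a + b}) : exists u v, m = mcat u v.
Proof.
exists [multinom m (lshift b i) | i < a], [multinom m (rshift a i) | i < b].
by apply/mnmP => i; case: (splitP i) => j ij;
  [have -> : i = lshift b j by apply: val_inj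
  |have -> : i = rshift a j by apply: val_inj];
  rewrite ?mcat_l ?mcat_r mnmE.
Qed.

(** Such a monomial is uniquely a product of one of degree d - e in the k + 1 head variables and one
    of degree e in the c + 1 tail variables. *)
Lemma count_tdeg k c d e : (e <= d)%N ->
  count (fun m => tdeg k m == e) (monos (k.+1 + c.+1) d) =
  ('C(d - e + k, k) * 'C(e + c, c))%N.
Proof.
move=> led; rewrite -!size_monos -(size_allpairs (@mcat k.+1 c.+1)).
rewrite -size_filter.
apply: perm_size; apply: uniq_perm.
- exact/filter_uniq/uniq_monos.
- apply: allpairs_uniq; [exact: uniq_monos|exact: uniq_monos|].
  by move=> [u v] [u' v'] _ _ /= E; apply: mcat_inj.
move=> m; rewrite mem_filter mem_monos; apply/andP/allpairsP => [[]|[[u v] /=]].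
  have [u [v ->]] := mcat_surj m; rewrite tdeg_mcat mdeg_mcat.
  move=> /eqP Ev /eqP Em.
  by exists (u, v); rewrite !mem_monos /= Ev -Em Ev addnK !eqxx.
rewrite !mem_monos => -[/eqP Eu /eqP Ev ->].
by rewrite tdeg_mcat mdeg_mcat Eu Ev subnK.
Qed.

Lemma count_lt_sum (T : Type) (f : T -> nat) (s : seq T) l :
  count (fun m => f m < l)%N s = (\sum_(e < l) count (fun m => f m == e) s)%N.
Proof.
elim: s => [|m s IH] /=; first by rewrite big1.
rewrite big_split /= -IH; congr (_ + _)%N; have [ltml|lelm] := ltnP.
  rewrite (bigD1 (Ordinal ltml)) //= eqxx big1 // => e.
  rewrite -val_eqE /= eq_sym.
  by move/negPf->.
rewrite big1 // => e _; case: eqP => // E.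
by have := leq_trans (ltn_ord e) lelm; rewrite E ltnn.
Qed.

Lemma count_tdeg_ge n k d l : (k < n)%N -> (l <= d)%N ->
  (count (fun m => l <= tdeg k m) (monos n.+1 d) +
   \sum_(e < l) 'C(d - e + k, k) * 'C(e + n - k - 1, n - k - 1))%N =
  'C(d + n, n).
Proof.
(* The n + 1 variables are k + 1 head variables and c + 1 = n - k tail variables. *)
move=> kn lel; have [c ->] : exists c, n = (k + c.+1)%N.
  by exists (n - k - 1)%N; lia.
rewrite -size_monos -(count_predC (fun m => l <= tdeg k m)%N); congr (_ + _)%N.
rewrite (eq_count (a2 := fun m => tdeg k m < l)%N); last first.
  by move=> m; rewrite /= -ltnNge.
rewrite count_lt_sum; apply: eq_bigr => e _.
rewrite -addnBA ?leq_addr // addKn -addnBA // subn1 /=.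
by rewrite (@count_tdeg k c) // (leq_trans _ lel) // ltnW.
Qed.

End MonomialCount.

(** * Powers of (x_(k+1), ..., x_n) as monomial ideals *)

Section MonomialIdeal.
Variables (K : fieldType) (n k : nat).
Local Notation R := {mpoly K[n.+1]}.
Implicit Types (p q : R).

Definition tail_ge l : R -> Prop := fun p =>
  forall m, m \in msupp p -> (l <= tdeg k m)%N.

Lemma ideal_tail_ge l : ideal_of ringR (tail_ge l).
Proof.
split=> [m|p q Hp Hq m|p q _ Hq m]; first by rewrite msupp0.
  by move/msuppD_le; rewrite mem_cat => /orP[/Hp|/Hq].
move/msuppM_le/allpairsP => [[m1 m2] /= [_ /Hq H ->]].
by rewrite tdegD (leq_trans H) // leq_addl.
Qed.

(** Tail degrees add under multiplication; conversely a monomial of tail degree e >= l is in the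
    e-th power of the ideal, hence in the l-th. *)
Lemma ipow_tailP l p :
  ipow ringR (igen ringR (xvars_gt k)) l p <-> tail_ge l p.
Proof.
have HS := @subalg_ringR K n; split.
  apply: ipow_ind => // [{}l|{}l f q If Hq]; first exact: ideal_tail_ge.
  have Hf : tail_ge 1 f.
    apply: igen_sub If; first exact: ideal_tail_ge.
    move=> _ [i ki ->] m; rewrite msuppX inE => /eqP ->.
    by rewrite /tdeg (bigD1 i) //= mnm1E eqxx.
  move=> m /msuppM_le/allpairsP[[m1 m2] /= [/Hf H1 /Hq H2 ->]].
  by rewrite tdegD -add1n leq_add.
move=> Hp; set I := igen _ _; rewrite [p]mpolyE big_seq.
have HI e := ipow_ideal I e HS.
apply: (ideal_sum _ (HI l)) => m /Hp lem; apply: (idealZ HS (HI l)).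
apply: ipow_anti_ringR lem _; rewrite mpolyXE_id /tdeg big_mkcond.
(* The exponent and the monomial are built together, one variable at a time; a head variable adds 0
   to the exponent, its powers lying in I^0 = R. *)
apply: (big_rec2 (fun e f => ipow ringR I e f)) => // i e f _ Hf.
apply: ipowM => //; case: ifP => // ki; apply: ipow_exp => //.
by apply: igen_in => //; exists i.
Qed.

(** The monomials counted form a basis: coefficient vectors indexed by them are mapped linearly and
    bijectively onto the forms. *)
Lemma hilb_tail_ge l (d : nat) :
  hilb (tail_ge l) d = count (fun m => l <= tdeg k m)%N (monos n.+1 d).
Proof.
have HT : subspace (tail_ge l).
  by apply: (ideal_subspace (@subalg_ringR K n)); apply: ideal_tail_ge.
rewrite -size_filter; set s := filter _ _.
have us : uniq s by apply/filter_uniq/uniq_monos.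
have memS i : (i < size s)%N ->
    (l <= tdeg k (nth 0%MM s i))%N /\ mdeg (nth 0%MM s i) = d.
  by move/(mem_nth 0%MM); rewrite mem_filter mem_monos => /andP[? /eqP].
pose g0 (r : 'rV[K]_(size s)) : R := \sum_i r 0 i *: 'X_[nth 0%MM s i].
have g0h r : g0 r \is d.-homog.
  apply: rpred_sum => i _; apply: rpredZ; rewrite dhomogX /=.
  by have [_ ->] := memS i (ltn_ord i).
have g0c r (i : 'I_(size s)) : (g0 r)@_(nth 0%MM s i) = r 0 i.
  rewrite raddf_sum (bigD1 i) //= mcoeffZ mcoeffX eqxx mulr1 big1 ?addr0 //.
  move=> j ji; rewrite mcoeffZ mcoeffX nth_uniq // (inj_eq val_inj).
  by rewrite (negPf ji) mulr0.
pose g r := DHomog (g0h r).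
transitivity (\dim {:'rV[K]_(size s)}); last by rewrite dimvf /dim /= mul1n.
symmetry; apply: (dim_linear_inj (g := g)) => [c u v|u v|u _|p].
- apply: val_inj; rewrite /= /g0 scaler_sumr -big_split /=.
  by apply: eq_bigr => i _; rewrite !mxE scalerDl scalerA.
- by move/(congr1 val) => /= E; apply/rowP => i; rewrite -!g0c E.
- apply/forms_ofP => //=.
  apply: (ideal_sum _ (ideal_tail_ge l)) => i _.
  apply: (idealZ (@subalg_ringR K n) (ideal_tail_ge l)) => m.
  by rewrite msuppX inE => /eqP ->; have [] := memS i (ltn_ord i).
move/(forms_ofP _ HT) => Hp; exists (\row_i (val p)@_(nth 0%MM s i)).
  exact: memvf.
apply: val_inj; apply/mpolyP => m /=.
have [ms|nms] := boolP (m \in s).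
  have lti : (index m s < size s)%N by rewrite index_mem.
  by rewrite -(nth_index 0%MM ms) (g0c _ (Ordinal lti)) mxE.
rewrite memN_msupp_eq0; last first.
  apply: contra nms => mp; rewrite mem_filter mem_monos Hp //.
  by have /dhomogP H := dhomog_is_dhomog p; apply/eqP/(H m mp).
rewrite /g0 raddf_sum big1 // => i _; rewrite /= mcoeffZ mcoeffX.
case: eqP => [E|]; last by rewrite mulr0.
by rewrite -E mem_nth in nms.
Qed.

(** The tail degree of a monomial is at most its degree, so no monomial is left in degrees below
    l. *)
Lemma hilb_tail_small J l (t : int) : subspace J ->
  (forall p, J p -> tail_ge l p) -> t < l%:Z -> hilb J t = 0%N.
Proof.
case: t => // d HJ Jtail ltdl; apply: hilb_eq0 => // p /dhomogP ph /Jtail Hp.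
apply/eqP; rewrite -msupp_eq0; apply/eqP/(_ : _ = [::]).
case E : (msupp p : seq _) => [|m s] //.
have mp : m \in msupp p by rewrite E mem_head.
by have := leq_trans (Hp m mp) (tdeg_le k m); rewrite (ph m mp); lia.
Qed.

End MonomialIdeal.

(** * Adapted coordinates *)

Section AdaptedBasis.
Variables (K : fieldType) (n : nat).
Implicit Types (A L H P : 'M[K]_n.+1) (D : pred 'I_n.+1).

(** A diagonal idempotent: substituting with it sets the variables in [D] to 0, and its row space is
    spanned by the unit vectors outside [D]. *)
Definition kill_mx D : 'M[K]_n.+1 := \matrix_(j, i) ((i == j) && ~~ D i)%:R.

Lemma lin_kill D i : lin (kill_mx D) i = if D i then 0 else 'X_i.
Proof.
rewrite /lin (bigD1 i) //= mxE eqxx /= big1 ?addr0 => [|j ji].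
  by case: (D i); rewrite ?scale0r ?scale1r.
by rewrite mxE eq_sym (negPf ji) scale0r.
Qed.

Lemma kill_mulmx D A : kill_mx D *m A =
  \matrix_i (if D i then 0 else row i A).
Proof.
apply/matrixP => i j; rewrite !mxE (bigD1 i) //= mxE eqxx big1 ?addr0.
  by case: (D i) => /=; rewrite mxE ?mul0r ?mul1r.
by move=> a ai; rewrite mxE (negPf ai) mul0r.
Qed.

Lemma kill_idem D : kill_mx D *m kill_mx D = kill_mx D.
Proof.
rewrite kill_mulmx; apply/matrixP => i j; rewrite !mxE.
case: ifP => Di; rewrite !mxE //.
by have [->|] := eqVneq j i; rewrite ?Di.
Qed.

Lemma Ivar_kill D A : (0 < \rank A)%N -> (A :=: kill_mx D)%MS ->
  eqset (Ivar A) (igen ringR (fun p => exists2 i, D i & p = 'X_i)).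
Proof.
move=> rA AD.
have HP : is_proj A (kill_mx D).
  split; first by rewrite AD.
  by have /submxP[w ->] : (A <= kill_mx D)%MS; rewrite ?AD // -mulmxA kill_idem.
have HI G := @igen_ideal K n ringR G (@subalg_ringR K n).
move=> p; rewrite (Ivar_igen rA HP); split; apply: igen_sub (HI _) _ p.
  move=> _ [i ->]; rewrite lin_kill; case: ifP => Di.
    by rewrite subr0; apply: igen_in => //; exists i.
  by rewrite subrr; case: (HI (fun p => exists2 i, D i & p = 'X_i)).
move=> _ [i Di ->]; apply: igen_in => //; exists i.
by rewrite lin_kill Di subr0.
Qed.

(* A basis b_0, ..., b_n of K^(n+1) with L = <b_0, ..., b_k> and
   H = <b_1, ..., b_n>. *)
Lemma ex_adapted_basis L H k : \rank L = k.+1 -> \rank H = n ->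
  ~~ (L <= H)%MS ->
  exists2 B : 'M[K]_n.+1, B \in unitmx &
    (forall i : 'I_n.+1, (i <= k)%N -> (row i B <= L)%MS) /\
    (forall i : 'I_n.+1, i != ord0 -> (row i B <= H)%MS).
Proof.
move=> rL rH LH; have /row_subPn[a aH] := LH.
(* b_0 = w is in L but not in H; b_1, ..., b_k is a basis of C, the intersection of H and L, and
   b_(k+1), ..., b_n one of a complement D of C in H. *)
set w := row a L in aH; have wL : (w <= L)%MS by apply: row_sub.
pose C := (H :&: L)%MS; pose D := (H :\: L)%MS.
have rHw m (A : 'M[K]_(m, n.+1)) : (H <= A)%MS -> ~~ (A <= H)%MS ->
    \rank A = n.+1.
  move=> HA nAH; apply/eqP; rewrite eqn_leq rank_leq_col -{1}rH.
  by apply: rank_ltmx; rewrite ltmxE HA.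
have rC : \rank C = k.
  have := mxrank_sum_cap H L; rewrite (rHw _ (H + L)%MS) ?addsmxSl //.
    rewrite rH rL /C; lia.
  by apply: contra LH; apply: submx_trans; apply: addsmxSr.
have rD : \rank D = (n - k)%N.
  by have := mxrank_cap_compl H L; rewrite rH -/C -/D rC; lia.
have kn : (k <= n)%N by have := mxrankS (capmxSl H L); rewrite -/C rC rH.
pose rows m (A : 'M[K]_(m, n.+1)) := [seq row i A | i <- enum 'I_m].
pose s : seq 'rV[K]_n.+1 := w :: rows _ (row_base C) ++ rows _ (row_base D).
have size_rows m (A : 'M[K]_(m, n.+1)) : size (rows _ A) = m.
  by rewrite size_map size_enum_ord.
have ss : size s = n.+1 by rewrite /= size_cat !size_rows rC rD subnKC.
have rowsP m (A : 'M[K]_(m, n.+1)) v : v \in rows _ A -> (v <= A)%MS.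
  by case/mapP => i _ ->; apply: row_sub.
pose B : 'M[K]_n.+1 := \matrix_i nth 0 s i.
have sB v : v \in s -> (v <= B)%MS.
  move=> vs; have lti : (index v s < n.+1)%N.
    by rewrite -[X in (_ < X)%N]ss index_mem.
  have <- : row (Ordinal lti) B = v by rewrite rowK nth_index.
  exact: row_sub.
have CB : (C <= B)%MS.
  rewrite -(eq_row_base C); apply/row_subP => i; apply: sB.
  by rewrite in_cons mem_cat (map_f (fun i => row i _)) ?orbT ?mem_enum.
have DB : (D <= B)%MS.
  rewrite -(eq_row_base D); apply/row_subP => i; apply: sB.
  rewrite in_cons mem_cat; apply/orP; right; apply/orP; right.
  by rewrite (map_f (fun i => row i _)) ?mem_enum.
have HB : (H <= B)%MS by rewrite -(addsmx_diff_cap_eq H L) addsmx_sub DB CB.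
exists B.
  (* The row space of [B] contains the hyperplane H and the vector w outside it. *)
  rewrite -row_full_unit /row_full (rHw _ B) //.
  by apply: contra aH; apply: submx_trans; apply: sB; apply: mem_head.
(* Row 0 is w, so row i + 1 is entry i of the concatenated bases, the first k of which lie in C. *)
split=> -[[|i] lti] //=; rewrite rowK //= nth_cat size_rows => ik.
  have iC : (i < \rank C)%N by rewrite rC.
  rewrite iC; apply: submx_trans (capmxSr H L); rewrite -/C -(eq_row_base C).
  by apply: rowsP; rewrite mem_nth // size_rows.
case: ltnP => iC.
  apply: submx_trans (capmxSl H L); rewrite -/C -(eq_row_base C).
  by apply: rowsP; rewrite mem_nth // size_rows.
apply: submx_trans (diffmxSl H L); rewrite -/D -(eq_row_base D).
apply: rowsP; rewrite mem_nth // size_rows rD ltn_subLR // rC subnKC //.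
Qed.

(** The hypothesis gives one inclusion, and equality of ranks makes it an equality. *)
Lemma eqmx_coord A B P : B \in unitmx -> \rank A = \rank P ->
  (P *m B <= A)%MS -> (A *m invmx B :=: P)%MS.
Proof.
move=> uB rAP PBA; apply/eqmxP.
have PA : (P <= A *m invmx B)%MS by rewrite -[P](mulmxK uB) submxMr.
rewrite PA andbT -(mxrank_leqif_sup PA) -rAP mxrankMfree //.
by rewrite row_free_unit unitmx_inv.
Qed.

Lemma adaptedP L H k : (0 < \rank L)%N -> (0 < \rank H)%N ->
  (L :=: kill_mx (fun i => k < i)%N)%MS -> pdim L = k ->
  (H :=: kill_mx (pred1 ord0))%MS -> adapted L H.
Proof.
move=> rL rH EL kL EH; split.
  move=> p; rewrite (Ivar_kill rH EH).
  have HI G := @igen_ideal K n ringR G (@subalg_ringR K n).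
  split; apply: igen_sub (HI _) _ p => q.
    by case=> i /eqP -> ->; apply: igen_in.
  by move=> ->; apply: igen_in => //; exists ord0 => //=.
by rewrite kL; apply: Ivar_kill.
Qed.

Lemma kill_gt_rank k : (k <= n)%N -> \rank (kill_mx (fun i => k < i)%N) = k.+1.
Proof.
move=> kn; rewrite -[RHS](@rank_pid_mx K n.+1 n.+1) ?ltnS //; congr (\rank _).
apply/matrixP => i j; rewrite !mxE eq_sym -leqNgt ltnS.
by case: eqVneq => [->|/negPf E]; rewrite ?eqxx //= val_eqE E.
Qed.

Lemma kill0_rank : \rank (kill_mx (pred1 ord0)) = n.
Proof.
transitivity (\rank (@copid_mx K n.+1 1)); last first.
  by rewrite rank_copid_mx // subn1.
congr (\rank _).
apply/matrixP => i j; rewrite !mxE ltnS leqn0 [j == i]eq_sym.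
case: (eqVneq i j) => [->|/negPf E]; rewrite ?eqxx /=.
  by rewrite -val_eqE /=; case: eqP => _; rewrite (subrr, subr0).
by rewrite val_eqE E subr0.
Qed.

Lemma ex_adapted L H : is_linsub L -> is_hyperplane H -> ~~ (L <= H)%MS ->
  exists2 g : 'M[K]_n.+1, g \in unitmx & adapted (L *m g) (H *m g).
Proof.
move=> /andP[rL rLn] [/andP[rH rHn] dH] LH.
have [k rk] : exists k, \rank L = k.+1 by exists (\rank L).-1; rewrite prednK.
have rHE : \rank H = n.
  by move: dH; rewrite /pdim; lia.
have [B uB [BL BH]] := ex_adapted_basis rk rHE LH.
have kn : (k <= n)%N by lia.
have uB' : invmx B \in unitmx by rewrite unitmx_inv.
have rg A : \rank (A *m invmx B) = \rank A.
  by rewrite mxrankMfree // row_free_unit.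
(* In the coordinates v B^(-1) the vectors b_i become the unit vectors. *)
exists (invmx B) => //; apply: (@adaptedP _ _ k); rewrite /pdim ?rg ?rk //.
  apply: eqmx_coord => //; first by rewrite rk kill_gt_rank.
  rewrite kill_mulmx; apply/row_subP => i; rewrite rowK.
  by case: ifPn => [_|]; rewrite ?sub0mx // -leqNgt => /BL.
apply: eqmx_coord => //; first by rewrite rHE kill0_rank.
rewrite kill_mulmx; apply/row_subP => i; rewrite rowK.
by case: ifPn => [_|/BH]; rewrite ?sub0mx.
Qed.

End AdaptedBasis.

(** * The ideals of an inclic *)

Section InclicIdeals.
Variables (K : fieldType) (n : nat).
Local Notation R := {mpoly K[n.+1]}.
Implicit Types (p q f : R) (A B : 'M[K]_n.+1).
Local Notation x0 := (@xvar0 K n).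

(** A form in I_A vanishes at the rows of [A], which would then lie in [B]. *)
Lemma linear_form_notin f A B : (0 < \rank A)%N -> is_linear_form_of f B ->
  ~~ (A <= B)%MS -> ~ Ivar A f.
Proof.
move=> rA [_ fB] /negP AB fA; apply: AB; apply/row_subP => i.
by apply/fB/(Ivar_eval rA _ fA)/row_sub.
Qed.

Lemma inclic_mulmx r s (L : 'I_r.+1 -> 'M[K]_n.+1) (H : 'I_s.+1 -> 'M[K]_n.+1)
    (g : 'M[K]_n.+1) : g \in unitmx -> inclic L H ->
  inclic (fun i => L i *m g) (fun j => H j *m g).
Proof.
move=> ug [Hl Hh C1 [C2 C2'] C3 C4].
have fg : row_free g by rewrite row_free_unit.
have rg A : \rank (A *m g) = \rank A by rewrite mxrankMfree.
have sg A B : (A *m g <= B *m g)%MS = (A <= B)%MS by rewrite submxMfree.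
split; rewrite /is_hyperplane /is_linsub /pdim.
- by move=> i; rewrite rg; apply: Hl.
- by move=> j; rewrite rg; apply: Hh.
- by move=> i j; rewrite !sg => /C1.
- by split=> [i /C2|]; rewrite sg.
- by move=> i j; rewrite sg => /C3.
- by move=> i j /C4 Hi; rewrite sg.
Qed.

Lemma dhomog_prod_exp (T : Type) (r : seq T) (e : T -> R) (h : T -> nat) :
  (forall j, e j \is 1.-homog) ->
  \prod_(j <- r) e j ^+ h j \is (\sum_(j <- r) h j)%N.-homog.
Proof.
move=> eh; apply: (big_rec2 (fun f d => f \is d.-homog)); first exact: dhomog1.
move=> j f d _ fd; apply: dhomogM => //.
by have := dhomogMn (h j) (eh j); rewrite mul1n.
Qed.

(** * Splitting the hyperplanes off I_X *)

Section Hyperplanes.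
Variables (r s : nat) (L : 'I_r.+1 -> 'M[K]_n.+1) (H : 'I_s.+1 -> 'M[K]_n.+1).
Variables (l : 'I_r.+1 -> nat) (h : 'I_s -> nat) (eta : 'I_s -> R).
Hypotheses (LH : inclic L H)
  (Heta : forall j, is_linear_form_of (eta j) (H (lift ord0 j))).

Lemma linear_form_notin_L i j : ~ Ivar (L i) (eta j).
Proof.
case: LH => Hl _ _ _ _ C4.
apply: (linear_form_notin _ (Heta j)); first by case/andP: (Hl i).
by apply: C4.
Qed.

(** An inclusion of hyperplanes is an equality by rank, which (C1) excludes for distinct indices. *)
Lemma linear_form_notin_H i j : i != j -> ~ Ivar (H (lift ord0 i)) (eta j).
Proof.
case: LH => _ Hh C1 _ _ _ ij.
have [/andP[ri rin] di] := Hh (lift ord0 i).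
have [/andP[rj rjn] dj] := Hh (lift ord0 j).
apply: (linear_form_notin _ (Heta j)) => //; apply: contra ij => Hij.
apply/eqP/(@lift_inj _ ord0)/C1; rewrite Hij.
rewrite -(geq_leqif (mxrank_leqif_sup Hij)) /=.
by move: di dj; rewrite /pdim; lia.
Qed.

(** The product divides p by [dvd_prod_linear_forms], and the quotient stays in every I_(L_i)^(l_i)
    because (C4) keeps the eta_j out of I_(L_i). *)
Lemma IX_factor :
  eqset (IX L H l h) (scale_set (\prod_(j < s) eta j ^+ h j) (IW L l)).
Proof.
case: (LH) => Hl Hh _ _ _ _ p.
have HI i : is_linsub (H (lift ord0 i)) by case: (Hh (lift ord0 i)).
split=> [[Wp Hp]|[q Wq ->]].
  have [q Ep] := dvd_prod_linear_forms (index_enum_uniq _) HI Heta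
    linear_form_notin_H (fun i _ => Hp i).
  exists q => // i; have /andP[ri _] := Hl i.
  apply: (ipow_Ivar_cancel_prod (r := index_enum _) (e := eta) (h := h) ri).
    by move=> j _; apply: linear_form_notin_L.
  by rewrite -Ep; apply: Wp.
split; first by have [_ _ WM] := ideal_Ischeme L l; apply: WM.
move=> j; rewrite (bigD1 j) //= -mulrA mulrC.
have [_ _ IM] := ipow_ideal (Ivar (H (lift ord0 j))) (h j) (@subalg_ringR K n).
apply: IM => //; apply: ipow_exp => //.
by apply/(Ivar_linear_form (HI j) (Heta j))/igen_in.
Qed.

Lemma hilb_IX (t : int) :
  hilb (IX L H l h) t = hilb (IW L l) (t - (\sum_(j < s) h j)%N%:Z).
Proof.
have HW := ideal_subspace (@subalg_ringR K n) (ideal_Ischeme L l).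
have HX : subspace (IX L H l h).
  by apply: subspace_meet => //; apply: ideal_subspace (ideal_Ischeme _ _).
rewrite (eq_hilb _ HX (subspace_scale _ HW) IX_factor); apply: hilb_scale => //.
  (* eta_j is nonzero since it is outside [Ivar (L ord0)], which contains 0. *)
  apply/prodf_neq0 => j _; apply: expf_neq0; apply/eqP => e0.
  apply: (@linear_form_notin_L ord0 j); rewrite e0.
  by case: (@igen_ideal K n ringR (fun f => (exists d : nat, f \is d.-homog) /\
    vanishes_on (L ord0) f) (@subalg_ringR K n)).
by apply: dhomog_prod_exp => j; case: (Heta j).
Qed.

End Hyperplanes.

(** * The decomposition of I_W by powers of x_0 *)

Section Decomposition.
Variables (r s : nat) (L : 'I_r.+1 -> 'M[K]_n.+1) (H : 'I_s.+1 -> 'M[K]_n.+1).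
Variables (l : 'I_r.+1 -> nat).
Hypotheses (LH : inclic L H) (HL : adapted (L ord0) (H ord0)).
Local Notation k := (pdim (L ord0)).
Local Notation l0 := (l ord0).
Local Notation l' := (lmax l).
Local Notation JY := (fun j => trunc (IY' L l j) k l0).
Local Notation F := (fun j => scale_set (x0 ^+ j) (JY j)).

Lemma xvars_gt_ringR' p : xvars_gt k p -> ringR' p.
Proof.
by case=> i ki ->; apply: ringR'_X; apply: contraTneq ki => ->.
Qed.

Lemma x0_in_Ivar (i : 'I_r) : Ivar (L (lift ord0 i)) x0.
Proof.
case: LH => _ _ _ [C2 _] _ _; apply: (@Ivar_sub _ _ _ (H ord0)).
  exact: C2.
by have [H0 _] := HL; apply/H0/igen_in.
Qed.

Lemma IZ_P p : IZ L l p <-> ipow ringR (igen ringR (xvars_gt k)) l0 p.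
Proof. by have [_ HL0] := HL; apply: eq_ipow. Qed.

Lemma IZ_coefP p : IZ L l p <-> forall j,
  ipow ringR' (igen ringR' (xvars_gt k)) l0 (xco p)`_j.
Proof.
have GR' := xvars_gt_ringR'; rewrite IZ_P (ipow_R'_coefP _ _ GR').
by split=> Hp j; have := Hp j;
  rewrite (ipow_ringR'P _ GR' (@xco_ringR' _ _ p j)).
Qed.

(** For i > 0, x_0 is in I_(L_i) by (C2), and the coefficient of x_0^j must be in I_(L_i)^(l_i - j):
    this is I_(Y'_j). For i = 0 the ideal is generated in R', and the same condition on all
    coefficients is the truncation. *)
Lemma IW_P : eqset (IW L l) (xgraded JY).
Proof.
move=> p; split=> [Wp j|Hp i].
  split; last by move/IZ_coefP: (Wp ord0).
  split; last exact: xco_ringR'.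
  by move=> i; apply: (ipow_x0_coefP _ _ (x0_in_Ivar i)).1 (Wp _) j.
case: (unliftP ord0 i) => [i' ->|->]; last first.
  by apply/IZ_coefP => j; case: (Hp j).
apply/(ipow_x0_coefP _ _ (x0_in_Ivar i')) => j.
by case: (Hp j) => -[+ _] _; apply.
Qed.

(** From j = l' on, all multiplicities l_i - j are 0 and only the condition from L_0 remains. *)
Lemma JY_lmax j p : (l' <= j)%N ->
  trunc (IY' L l j) k l0 p <->
  ringR' p /\ ipow ringR' (igen ringR' (xvars_gt k)) l0 p.
Proof.
move=> lj; split=> [[[_ ?] ?]|[pR' Hp]] //; do !split=> //.
move=> i; suff -> : (l (lift ord0 i) - j)%N = 0%N by [].
apply/eqP; rewrite subn_eq0 (leq_trans _ lj) //.
exact: (@leq_bigmax _ (fun i : 'I_r => l (lift ord0 i)) i).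
Qed.

Lemma IZ'_P j : (l' <= j)%N -> eqset (IZ' L l) (JY j).
Proof.
have GR' := xvars_gt_ringR'.
move=> lj p; rewrite (JY_lmax _ lj); split=> [[/IZ_P Zp pR']|[pR' Hp]].
  by split=> //; apply/(ipow_ringR'P _ GR' pR').
by split=> //; apply/IZ_P/(ipow_ringR'P _ GR' pR').
Qed.

Lemma IZ_shiftP : eqset (IZ L l) (xgraded (fun j => JY (l' + j)%N)).
Proof.
move=> p; rewrite IZ_coefP; split=> Hp j.
  by apply/JY_lmax; [apply: leq_addr | split=> //; apply: xco_ringR'].
by have /JY_lmax[] := Hp j; rewrite ?leq_addr.
Qed.

Lemma JY_subspace j : subspace (JY j).
Proof.
have HS := @subalg_ringR' K n; apply: subspace_meet.
  apply: subspace_meet; last exact: ideal_subspace (subalg_ideal HS).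
  exact: ideal_subspace (ideal_Ischeme _ _).
exact: ideal_subspace (ipow_ideal _ _ HS).
Qed.

Lemma JY_ringR' j p : JY j p -> ringR' p.
Proof. by case=> -[]. Qed.

Lemma IW_direct_sum : is_direct_sum (IW L l) xpredT F.
Proof.
have [D1 D2] := is_direct_sum_xgraded JY_subspace JY_ringR'.
by split=> // p; rewrite IW_P D1.
Qed.

Lemma F_direct P : sum_is_direct P F.
Proof. exact: (sum_is_direct_scaled JY_ringR'). Qed.

Lemma eq_direct_sum2 (I J J1 J2 : R -> Prop) : eqset I J ->
  is_direct_sum2 J J1 J2 -> is_direct_sum2 I J1 J2.
Proof. by move=> IJ [D1 D2]; split=> // p; rewrite IJ D1. Qed.

Lemma scale_IZ'_P j : (l' <= j)%N ->
  eqset (scale_set (x0 ^+ j) (IZ' L l)) (F j).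
Proof.
by move=> lj p; split=> -[q Hq ->]; exists q => //; apply/(IZ'_P lj).
Qed.

Lemma F'_direct :
  sum_is_direct (fun j => (l' <= j)%N) (fun j => scale_set (x0 ^+ j) (IZ' L l)).
Proof.
move=> N f Ff; apply: F_direct => j ltj lj; apply/scale_IZ'_P => //; exact: Ff.
Qed.

(** With [hilb_tail_small], this kills the summands with t - j < l_0 of the Hilbert function. *)
Lemma JY_tail_ge j p : JY j p -> tail_ge k l0 p.
Proof.
case=> _ Hp; apply/ipow_tailP; apply: ipow_mono Hp => //.
  exact: subalg_ringR'.
apply: (@igen_sub _ _ ringR'); last by move=> u Gu; apply: igen_in.
have [I0 ID IM] := @igen_ideal K n _ (xvars_gt k) (@subalg_ringR K n).
by split=> // u v _; apply: IM.
Qed.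

End Decomposition.

End InclicIdeals.

(** The terms with t - a < j < b vanish, so cutting the sum there loses nothing; when the bound is
    negative, either b = 0 or all terms vanish. *)
Lemma sum_upto_min (b a : nat) (t : int) (f : nat -> nat) :
  (forall j : nat, t - j%:Z < a%:Z -> f j = 0%N) ->
  sum_upto (Num.min (b%:Z - 1) (t - a%:Z)) f = (\sum_(j < b) f j)%N.
Proof.
move=> f0; case E : (Num.min _ _) => [m|m] /=; last first.
  by rewrite big1 // => j _; apply: f0; have := ltn_ord j; lia.
have lemb : (m.+1 <= b)%N by lia.
rewrite (big_ord_widen _ f lemb) [RHS](bigID (fun j : 'I_b => j < m.+1)%N) /=.
rewrite [X in (_ + X)%N]big1 ?addn0 // => j.
by rewrite -leqNgt => ltmj; apply: f0; have := ltn_ord j; lia.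
Qed.

(* Points of P^n are row vectors; the coordinates given by g in GL_(n+1)(K)
   assign to the point v the coordinate vector v *m g. *)
Theorem theorem3p1 (K : fieldType) (n r s : nat)
    (L_ : 'I_r.+1 -> 'M[K]_n.+1) (H_ : 'I_s.+1 -> 'M[K]_n.+1)
    (l : 'I_r.+1 -> nat) (h : 'I_s -> nat)
    (n_ge1 : (1 <= n)%N) (r_ge1 : (1 <= r)%N) (LH : inclic L_ H_) :
  (exists2 g : 'M[K]_n.+1, g \in unitmx &
     adapted (L_ ord0 *m g) (H_ ord0 *m g)) /\
  forall g : 'M[K]_n.+1, g \in unitmx ->
  let L := fun i => L_ i *m g in
  let H := fun j => H_ j *m g in
  adapted (L ord0) (H ord0) ->
  forall eta : 'I_s -> {mpoly K[n.+1]},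
  (forall j, is_linear_form_of (eta j) (H (lift ord0 j))) ->
  let k := pdim (L ord0) in
  let l0 := l ord0 in
  let l' := lmax l in
  let JY := fun j => trunc (IY' L l j) k l0 in
  let F := fun j => scale_set (xvar0 ^+ j) (JY j) in
  let F' := fun j => scale_set (xvar0 ^+ j) (IZ' L l) in
  let low := fun j => (j < l')%N in
  let high := fun j => (l' <= j)%N in
  [/\ eqset (IX L H l h) (scale_set (\prod_(j < s) eta j ^+ h j) (IW L l)) /\
      (forall t : int,
        hilb (IX L H l h) t = hilb (IW L l) (t - (\sum_(j < s) h j)%N%:Z)),
      [/\ is_direct_sum (IW L l) xpredT F,
          [/\ is_direct_sum2 (IW L l) (sum_set low F) (sum_set high F'),
              sum_is_direct low F &
              sum_is_direct high F'] &
          is_direct_sum2 (IW L l) (sum_set low F)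
            (scale_set (xvar0 ^+ l') (IZ L l)) /\
          sum_is_direct low F],
      forall t : int,
        let lambda := Num.min (l'%:Z - 1) (t - l0%:Z) in
        hilb (IW L l) t =
          (sum_upto lambda (fun j => hilb (JY j) (t - j%:Z))
           + hilb (IZ L l) (t - l'%:Z))%N &
      forall t : int,
        (t < l'%:Z + l0%:Z -> hilb (IZ L l) (t - l'%:Z) = 0%N)
        /\ (l'%:Z + l0%:Z <= t ->
            (hilb (IZ L l) (t - l'%:Z))%:Z =
              binz (t - l'%:Z + n%:Z) n
              - \sum_(i < l0)
                  binz (t - l'%:Z - i%:Z + k%:Z) k
                  * 'C(i + n - k - 1, n - k - 1)%:Z)].
Proof.
case: (LH) => Hl Hh _ [_ C2'] _ _; split; first exact: ex_adapted.
move=> g ug L H HL eta Heta k l0 l' JY F F' low high.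
have LH' : inclic L H by apply: inclic_mulmx.
have JYs := JY_subspace L l.
have JYR := @JY_ringR' K n r L l.
have HZ : subspace (IZ L l).
  exact: ideal_subspace (ipow_ideal _ _ (@subalg_ringR K n)).
split.
- by split; [apply: IX_factor | move=> t; apply: hilb_IX].
- split; first exact: IW_direct_sum LH' HL.
    split; first apply: eq_direct_sum2 (IW_P l LH' HL) _.
    + apply: is_direct_sum2_split => //.
      by move=> j lj; apply: (scale_IZ'_P HL).
    + exact: F_direct.
    + exact: (F'_direct HL).
  split; last exact: F_direct.
  apply: eq_direct_sum2 (IW_P l LH' HL) _.
  exact: (is_direct_sum2_shift JYs JYR (IZ_shiftP l HL)).
- move=> t lambda.
  rewrite (eq_hilb t _ _ (IW_P l LH' HL)); last 2 first.
  + exact: ideal_subspace (ideal_Ischeme _ _).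
  + exact: xgraded_subspace.
  (* Taking off l' factors x_0 leaves the sum over j < l' and, shifted by l', the Hilbert function
     of I_Z. *)
  rewrite (hilb_xgraded l' t JYs JYR); congr (_ + _)%N.
    rewrite sum_upto_min // => j ltj; apply: hilb_tail_small (JYs j) _ ltj => p.
    exact: JY_tail_ge.
  by apply: eq_hilb => //;
    [apply: xgraded_subspace | move=> p; rewrite (IZ_shiftP l HL)].
move=> t.
have IZ_tail : eqset (IZ L l) (tail_ge k l0).
  by move=> p; rewrite (IZ_P l HL) ipow_tailP.
(* L_0 is a proper subvariety, so there is at least one tail variable. *)
have kn : (k < n)%N.
  by case/andP: (inclic_linsub LH' ord0); rewrite /k /pdim; case: (\rank _).
have HT : subspace (@tail_ge K n k l0).
  exact (ideal_subspace (@subalg_ringR K n) (@ideal_tail_ge K n k l0)).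
split=> [ltt|let_].
  by apply: (hilb_tail_small (k := k) (l := l0)) => [//|p /IZ_tail //|]; lia.
rewrite (eq_hilb _ HZ HT IZ_tail).
have [d Ed] : exists d : nat, t - l'%:Z = d.
  by exists `|t - l'%:Z|%N; lia.
have l0d : (l0 <= d)%N by lia.
rewrite Ed hilb_tail_ge.
have := congr1 Posz (count_tdeg_ge kn l0d); rewrite PoszD => E.
rewrite -PoszD /= -E -[LHS](addrK (\sum_(e < l0) 'C(d - e + k, k) *
  'C(e + n - k - 1, n - k - 1))%N%:Z); congr (_ - _).
rewrite (big_morph Posz PoszD (erefl _)); apply: eq_bigr => e _.
(* As e < l_0 <= d, the integer t - l' - e is the natural number d - e, and [binz] is an ordinary
   binomial coefficient. *)
have eled : (e <= d)%N by rewrite (leq_trans _ l0d) // ltnW.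
by rewrite subzn // -PoszD /= PoszM.
Qed.
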